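(* Let $M$ be a compact manifold with (nonempty) boundary $\partial M$ such that no connected component of $M$ is homeomorphic to a closed interval. Then for every positive integer $n$, the set $$\{(f_1,\dots,f_n)\in \mathrm{Homeo}_0(M,\partial M)^n : \langle f_1,\dots,f_n\rangle \text{ is discrete}\}$$ contains an open dense subset of $\mathrm{Homeo}_0(M,\partial M)^n$.
   Context: $\mathrm{Homeo}_0(M,\partial M)$ denotes the connected component of the identity in the group of homeomorphisms of $M$ which fix every point of the boundary $\partial M$, equipped with the topology of uniform convergence ($C^0$ topology) and with composition as group operation. $\langle f_1,\dots,f_n\rangle$ denotes the generated subgroup, which is called discrete if its subspace topology in $\mathrm{Homeo}_0(M,\partial M)$ is discrete. $\mathrm{Homeo}_0(M,\partial M)^n$ carries the product topology. Manifolds are of pure dimension (all components have the same dimension). *)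

(* Defs.v *)
From HB Require Import structures.
From mathcomp Require Import all_boot all_order all_algebra.
From mathcomp Require Import all_classical all_reals topology normedtype.

Set Implicit Arguments.
Unset Strict Implicit.
Unset Printing Implicit Defensive.

Import Order.TTheory GRing.Theory Num.Theory.
Import numFieldNormedType.Exports.

Local Open Scope classical_set_scope.
Local Open Scope ring_scope.

Definition homeomorphism (T U : topologicalType) (f : T -> U) : Prop :=
  continuous f /\
  exists g : U -> T, [/\ continuous g, cancel f g & cancel g f].

Definition homeomorphic (T U : topologicalType) : Prop :=
  exists f : T -> U, homeomorphism f.

(* The condition bears on the coordinate of index 0, so it is empty (and the
   half space is the whole point R^0) when d = 0. *)
Definition half_space (R : realType) (d : nat) : set 'rV[R]_d :=
  [set v | forall i : 'I_d, val i = 0%N -> 0 <= v ord0 i].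

(* Topological manifold with (possibly empty) boundary, of pure dimension d.
   Sets coerce to types carrying the subspace topology. *)
Definition manifold (R : realType) (d : nat) (M : topologicalType) : Prop :=
  [/\ hausdorff_space M, @second_countable M &
    forall x : M, exists U : set M, exists V : set 'rV[R]_d,
      [/\ open U, U x, open V & homeomorphic U (V `&` @half_space R d)]].

Definition manifold_interior (R : realType) (d : nat) (M : topologicalType) :
    set M :=
  [set x | exists U : set M, exists V : set 'rV[R]_d,
    [/\ open U, U x, open V & homeomorphic U V]].

Definition boundary (R : realType) (d : nat) (M : topologicalType) : set M :=
  ~` @manifold_interior R d M.

Arguments half_space : clear implicits.
Arguments manifold_interior : clear implicits.
Arguments boundary : clear implicits.

Section HomeoGroup.
Context {M : uniformType} (B : set M).

Definition homeo_fix : set {uniform M -> M} :=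
  [set f | homeomorphism (f : M -> M) /\ forall x, B x -> f x = x].

Definition homeo0_set : set {uniform M -> M} :=
  connected_component homeo_fix idfun.

Lemma homeo_fix_id : homeo_fix idfun.
Proof.
split=> //; split; first by move=> x.
by exists idfun; split => // x.
Qed.

Lemma homeo_fix_comp f g :
  homeo_fix f -> homeo_fix g -> homeo_fix (f \o g).
Proof.
move=> [[cf [f' [cf' ff' f'f]]] fB] [[cg [g' [cg' gg' g'g]]] gB]; split.
  split; first by move=> x; apply: continuous_comp; [exact: cg|exact: cf].
  exists (g' \o f'); split.
  - by move=> x; apply: continuous_comp; [exact: cf'|exact: cg'].
  - exact: can_comp.
  - exact: can_comp.
by move=> x Bx /=; rewrite gB// fB.
Qed.

Lemma comp_uniform_continuous (g : M -> M) :
  continuous ((fun f => f \o g) : {uniform M -> M} -> {uniform M -> M}).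
Proof.
move=> f P /uniform_nbhs [E [entE EP]].
apply/uniform_nbhs; exists E; split => // h fh.
by apply: EP => x _ /=; exact: fh.
Qed.

Lemma homeo0_homeo f : homeo0_set f -> homeo_fix f.
Proof. exact: connected_component_sub. Qed.

Lemma homeo0_id : homeo0_set idfun.
Proof. exact/connected_component_refl/homeo_fix_id. Qed.

Lemma homeo0_compr f0 g : homeo_fix g -> homeo0_set f0 ->
  homeo0_set (f0 \o g) -> forall f, homeo0_set f -> homeo0_set (f \o g).
Proof.
move=> hg hf0 hf0g f hf; apply: connected_component_trans hf0g _.
exists ((fun h : {uniform M -> M} => h \o g : {uniform M -> M}) @` homeo0_set).
  split; first by exists f0.
    by move=> _ [h hh <-]; apply: homeo_fix_comp => //; exact: homeo0_homeo.
  apply: connected_continuous_connected; first exact: component_connected.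
  exact/continuous_subspaceT/comp_uniform_continuous.
by exists f.
Qed.

Lemma homeo0_comp f g : homeo0_set f -> homeo0_set g -> homeo0_set (f \o g).
Proof.
move=> hf hg; apply: (homeo0_compr (f0 := idfun)) => //.
- exact: homeo0_homeo.
- exact: homeo0_id.
Qed.

Lemma homeo0_inv f : homeo0_set f ->
  exists2 g : M -> M, homeo0_set g & cancel f g /\ cancel g f.
Proof.
move=> hf; have [[cf [g [cg fg gf]]] fB] := homeo0_homeo hf.
have hg : homeo_fix g.
  split; first by split => //; exists f.
  by move=> x Bx; rewrite -[in LHS](fB _ Bx) fg.
exists g => //; apply: (homeo0_compr hg hf _ homeo0_id).
rewrite (_ : f \o g = idfun); first exact: homeo0_id.
by apply/funext => x /=; rewrite gf.
Qed.

(* When M is compact Hausdorff, its topology is induced by a unique uniformity,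
   so that the topology of uniform convergence used here only depends on the
   topology of M. *)
Definition Homeo0 : Type := set_type homeo0_set.

HB.instance Definition _ := Topological.on Homeo0.

Definition homeo0_fun (f : Homeo0) : M -> M := set_val f.

Definition mk_homeo0 (f : M -> M) (hf : homeo0_set f) : Homeo0 :=
  SigSub (mem_set hf).

Lemma homeo0P (f : Homeo0) : homeo0_set (homeo0_fun f).
Proof. exact: set_valP. Qed.

Definition homeo0_one : Homeo0 := mk_homeo0 homeo0_id.

Definition homeo0_mul (f g : Homeo0) : Homeo0 :=
  mk_homeo0 (homeo0_comp (homeo0P f) (homeo0P g)).

Definition homeo0_V (f : Homeo0) : Homeo0 :=
  mk_homeo0 (s2valP (cid2 (homeo0_inv (homeo0P f)))).

Lemma homeo0_ext (f g : Homeo0) : homeo0_fun f =1 homeo0_fun g -> f = g.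
Proof. by move=> fg; apply/val_inj/funext. Qed.

Lemma homeo0_mulA : associative homeo0_mul.
Proof. by move=> f g h; exact: homeo0_ext. Qed.

Lemma homeo0_mul1 : left_id homeo0_one homeo0_mul.
Proof. by move=> f; exact: homeo0_ext. Qed.

Lemma homeo0_mulr1 : right_id homeo0_one homeo0_mul.
Proof. by move=> f; exact: homeo0_ext. Qed.

Lemma homeo0_mulV : left_inverse homeo0_one homeo0_V homeo0_mul.
Proof.
move=> f; apply: homeo0_ext => x; rewrite /homeo0_mul /homeo0_V /=.
exact: (s2valP' (cid2 (homeo0_inv (homeo0P f)))).1.
Qed.

Lemma homeo0_mulrV : right_inverse homeo0_one homeo0_V homeo0_mul.
Proof.
move=> f; apply: homeo0_ext => x; rewrite /homeo0_mul /homeo0_V /=.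
exact: (s2valP' (cid2 (homeo0_inv (homeo0P f)))).2.
Qed.

HB.instance Definition _ := isGroup.Build Homeo0
  homeo0_mulA homeo0_mul1 homeo0_mulr1 homeo0_mulV homeo0_mulrV.

End HomeoGroup.

Definition generated_subgroup (G : groupType) (A : set G) : set G :=
  [set g | forall H : set G, group_closed (mem H) -> A `<=` H -> H g].

Definition discrete_space (T : topologicalType) : Prop :=
  forall A : set T, open A.

(* Main.v *)
(** Let p be a boundary point. Every f_i fixes p, so it almost preserves a small
neighbourhood of p and can be altered there at small C^0 cost. In a coordinate
domain Omega ~ R^d with p in its closure, choose points a_0 and a_(i,+-) near p,
generic enough that a fixed coordinate separates them and their images.
Composing f_i with a homeomorphism supported in Omega, all small neighbourhoods
O_t of the points, except O_(i,-), are sent into O_(i,+), and symmetrically for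
the inverse. Ping-pong then shows that every nontrivial element of the group
sends a_0 to a point at positive distance from a_0, so the group is discrete;
and the ping-pong condition is open in the C^0 topology.

The homeomorphisms used (a shear followed by a contraction of a ball) need two
coordinates, i.e. d >= 2. When d = 0 there is no boundary. When d = 1, the
component of p is a closed interval: a ray issued from p is extended through
finitely many line charts until it reaches another endpoint.

Invariance of domain is never needed: only the fact that p itself is fixed is
used, and points are chosen generically so that their images lie in Omega. *)
Require Import Defs.
From mathcomp Require Import all_boot all_order all_algebra.
From mathcomp Require Import all_classical all_reals topology normedtype.
From mathcomp Require Import sequences exp lra.

Set Implicit Arguments.
Unset Strict Implicit.
Unset Printing Implicit Defensive.

Import Order.TTheory GRing.Theory Num.Theory.
Import numFieldNormedType.Exports.

Local Open Scope classical_set_scope.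
Local Open Scope ring_scope.

(** * Ping-pong in the homeomorphism group *)

Section UniformTopology.
Context {M : uniformType}.

(** Compactness reduces this to one point [x] of [K]. Half of the entourage is spent on the
    continuity of [f] at [x], the other half on the distance between [f] and [g]. *)
Lemma near_image_sub (f : {uniform M -> M}) (K O : set M) :
  continuous (f : M -> M) -> compact K -> open O -> f @` K `<=` O ->
  \forall g \near f, (g : M -> M) @` K `<=` O.
Proof.
move=> cf /compact_near_coveringP cK oO fKO.
suff : \forall g \near f, K `<=` [set x | O ((g : M -> M) x)].
  by apply: filterS => g gK _ [x Kx <-]; exact: gK.
apply: (cK _ (nbhs f) (fun g x => O (g x))) => x Kx.
have : nbhs (f x) O by apply: open_nbhs_nbhs; split => //; apply: fKO; exists x.
rewrite -nbhs_entourageE => -[E entE EO].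
have entE' := entourage_split_ent entE.
exists ([set y | (split_ent E) (f x, f y)],
        [set g : {uniform M -> M} | forall y, (split_ent E) (f y, g y)]).
  split.
    have : nbhs x (f @^-1` xsection (split_ent E) (f x)) by exact: cf.
    by apply: filterS => y /xsectionP.
  apply/uniform_nbhs; exists (split_ent E); split => // g fg y.
  exact: fg.
by case=> y g /= [h1 h2]; apply/EO/xsectionP; apply: (entourage_split (f y)).
Qed.

Lemma near_eval (f : {uniform M -> M}) (x : M) (O : set M) :
  open O -> O (f x) -> \forall g \near f, O ((g : M -> M) x).
Proof.
move=> oO Ofx; have : nbhs (f x) O by exact: open_nbhs_nbhs.
rewrite -nbhs_entourageE => -[E entE EO].
by apply/uniform_nbhs; exists E; split => // g /(_ x I) /= fg; exact/EO/xsectionP.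
Qed.

Context (B : set M).

Lemma homeo0_cts (f : Homeo0 B) : continuous (homeo0_fun f).
Proof. by have [[]] := homeo0_homeo (homeo0P f). Qed.

Lemma homeo0_fun_mk (f : M -> M) (hf : homeo0_set B f) :
  homeo0_fun (mk_homeo0 hf) = f.
Proof. by []. Qed.

Lemma homeo0_funM (f g : Homeo0 B) x :
  homeo0_fun (f * g)%g x = homeo0_fun f (homeo0_fun g x).
Proof. by []. Qed.

Lemma homeo0_funVK (f : Homeo0 B) : cancel (homeo0_fun f) (homeo0_fun f^-1%g).
Proof. by move=> x; rewrite -homeo0_funM mulVg. Qed.

Lemma homeo0_funKV (f : Homeo0 B) : cancel (homeo0_fun f^-1%g) (homeo0_fun f).
Proof. by move=> x; rewrite -homeo0_funM mulgV. Qed.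

Lemma homeo0_open (f : Homeo0 B) (O : set M) :
  open O -> open (homeo0_fun f @` O).
Proof.
move=> oO; rewrite (_ : _ @` O = homeo0_fun f^-1%g @^-1` O).
  by apply: open_comp => // x _; exact: homeo0_cts.
apply/seteqP; split=> [_ [x Ox <-]|x /= Ox]; first by rewrite /= homeo0_funVK.
by exists (homeo0_fun f^-1%g x); rewrite ?homeo0_funKV.
Qed.

Lemma near_homeo0 (f : Homeo0 B) (P : set {uniform M -> M}) :
  nbhs (homeo0_fun f : {uniform M -> M}) P -> nbhs f [set g | P (homeo0_fun g)].
Proof. exact: (@initial_continuous _ _ (@set_val _ (homeo0_set B))). Qed.

Lemma near_tuple (n : nat) (f : prod_topology (fun _ : 'I_n => Homeo0 B)) i
    (P : set {uniform M -> M}) :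
  nbhs (homeo0_fun (f i) : {uniform M -> M}) P ->
  \forall g \near f, P (homeo0_fun (g i)).
Proof.
move=> /near_homeo0.
exact: (@proj_continuous _ (fun _ : 'I_n => Homeo0 B) i f).
Qed.

End UniformTopology.

(** * Reduced words and the ping-pong argument *)

Section PingPong.
Context {G : groupType} {I : eqType} (f : I -> G).

Definition letter (s : I * bool) : G := if s.2 then f s.1 else (f s.1)^-1%g.

Definition flip (s : I * bool) : I * bool := (s.1, ~~ s.2).

Lemma letter_flip s : letter (flip s) = (letter s)^-1%g.
Proof. by case: s => i [] //=; rewrite /letter /= invgK. Qed.

Definition word (l : seq (I * bool)) : G :=
  foldr (fun s g => letter s * g)%g 1%g l.

Definition reduced (l : seq (I * bool)) :=
  sorted (fun s t => t != flip s) l.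

Lemma word_cat l1 l2 : word (l1 ++ l2) = (word l1 * word l2)%g.
Proof. by elim: l1 => [|s l IH] /=; rewrite ?mul1g // IH mulgA. Qed.

Lemma word_inv l : (word l)^-1%g = word (rev (map flip l)).
Proof.
elim: l => [|s l IH] /=; first by rewrite invg1.
by rewrite invgM IH rev_cons -cats1 word_cat /= mulg1 letter_flip.
Qed.

Lemma word_reduced l : exists2 l', reduced l' & word l = word l'.
Proof.
elim: l => [|s l [l' rl' IH]]; first by exists [::].
case: l' rl' IH => [|t l'] rl' /= ->; first by exists [:: s].
have [->|ts] := eqVneq t (flip s).
  exists l'; first exact: path_sorted rl'.
  by rewrite mulgA letter_flip mulgV mul1g.
by exists [:: s, t & l'] => //; rewrite /reduced /= ts.
Qed.

Lemma generated_word g : generated_subgroup (range f) g ->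
  exists l, g = word l.
Proof.
move=> /(_ [set g | exists l, g = word l]); apply; last first.
  by move=> _ [i _ <-]; exists [:: (i, true)]; rewrite /= mulg1.
split; first by rewrite inE; exists [::].
move=> x y; rewrite !inE => -[l ->] [l' ->].
by exists (l ++ rev (map flip l')); rewrite word_cat word_inv.
Qed.

Lemma generatedM g h : generated_subgroup (range f) g ->
  generated_subgroup (range f) h -> generated_subgroup (range f) (g / h)%g.
Proof.
move=> gg gh H HG fH.
by apply/set_mem; apply: HG.2; apply/mem_set; [exact: gg|exact: gh].
Qed.

Context {X : Type} (act : G -> X -> X) (C : option (I * bool) -> set X) (x0 : X).
Hypothesis act1 : forall x, act 1%g x = x.
Hypothesis actM : forall g h x, act (g * h)%g x = act g (act h x).
Hypothesis Cx0 : C None x0.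
Hypothesis CP : forall s t, t <> Some (flip s) ->
  act (letter s) @` C t `<=` C (Some s).

(** The piece holding the moving point records the letter applied last. In a reduced word the next
    letter is never its inverse, which is the only case that [CP] excludes. The first move starts
    from [C None]. *)
Lemma pingpong_word s l : reduced (s :: l) ->
  C (Some s) (act (word (s :: l)) x0).
Proof.
elim: l s => [|t l IH] s.
  by move=> _; rewrite /= actM act1; apply: (CP (t := None)) => //; exists x0.
move=> /= /andP[ts rl]; rewrite actM; apply: (CP (t := Some t)).
  by move=> [] /eqP; rewrite (negbTE ts).
by exists (act (word (t :: l)) x0) => //; exact: IH.
Qed.

Lemma pingpong g : generated_subgroup (range f) g -> g <> 1%g ->
  exists s, C (Some s) (act g x0).
Proof.
move=> /generated_word[l ->]; have [[|s l'] rl' ->] := word_reduced l => //.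
by exists s; exact: pingpong_word.
Qed.

End PingPong.

Section Schottky.
Context {M : uniformType} (B : set M) {n : nat}.
Implicit Types (f : 'I_n -> Homeo0 B) (O : option ('I_n * bool) -> set M).

(* The second condition says that the inverse of [f i] sends all pieces except
   the one of [(i, true)] into that of [(i, false)]; avoiding inverses makes it
   visibly open in [f]. *)
Definition schottky O f : Prop := forall i t,
  (t <> Some (i, false) ->
     homeo0_fun (f i) @` closure (O t) `<=` O (Some (i, true))) /\
  (t <> Some (i, true) ->
     homeo0_fun (f i) @` (~` O (Some (i, false))) `<=` ~` closure (O t)).

(** Keeping the base point off the other closures makes the complement of their finite union a
    neighbourhood of [x0]. Under [schottky], no nontrivial element brings [x0] back into it. *)
Definition schottky_data O : Prop :=
  (forall t, open (O t)) /\ exists x0, O None x0 /\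
    forall s, ~ closure (O (Some s)) x0.

(** If [h] is close to [g], then [h / g] moves [x0] little, whereas ping-pong throws [x0] into the
    closure of a piece as soon as [h / g] is nontrivial. Hence [g] is isolated. *)
Lemma schottky_discrete O f : schottky_data O -> schottky O f ->
  discrete_space (generated_subgroup (range f)).
Proof.
move=> [oO [x0 [Ox0 nx0]]] Sf A; rewrite openE => g Ag.
pose y0 := homeo0_fun (set_val g)^-1%g x0.
pose W := ~` (\bigcup_(s in [set: 'I_n * bool]) closure (O (Some s))).
have oW : open W.
  apply: closed_openC; apply: closed_bigcup => [|s _]; first exact: finite_finset.
  exact: closed_closure.
have : nbhs (set_val g) [set h : Homeo0 B | W (homeo0_fun h y0)].
  apply: (near_homeo0 (P := fun h : M -> M => W (h y0))).
  apply: near_eval => //; rewrite /y0 homeo0_funKV.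
  by move=> [s _]; exact: nx0.
move=> /(@initial_continuous _ _ (@set_val _ (generated_subgroup (range f))) g) nW.
have {nW} : nbhs g [set h | W (homeo0_fun (set_val h) y0)] by exact: nW.
apply: filterS => h /= Wh; suff -> : h = g by [].
apply/val_inj.
apply/eqP; rewrite -divg_eq1; apply/eqP; apply: contrapT => gh1.
have hgC : generated_subgroup (range f) (set_val h / set_val g)%g.
  by apply: generatedM; exact: set_valP.
(* For an inverse letter, this is the contrapositive of the second condition of [schottky]. *)
have CP s t : t <> Some (flip s) ->
    homeo0_fun (letter f s) @` closure (O t) `<=` closure (O (Some s)).
  case: s => i [] tn.
    by apply: subset_trans (@subset_closure _ _); exact: (Sf i t).1.
  apply: subset_trans (@subset_closure _ _) => _ [y Cy <-].
  apply: contrapT => nO; apply: ((Sf i t).2 tn) Cy.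
  by exists (homeo0_fun (f i)^-1%g y); rewrite ?homeo0_funKV.
have [s sC] := pingpong (act := @homeo0_fun _ B) (C := closure \o O)
  (fun=> erefl) (fun _ _ _ => erefl) (subset_closure Ox0) CP hgC gh1.
by apply: Wh; exists s => //; rewrite /y0 -homeo0_funM.
Qed.

(** For fixed pieces, the conditions are finitely many inclusions of the image of a compact set in
    an open set. Each of them survives a small uniform perturbation. *)
Lemma schottky_open : compact [set: M] ->
  open ([set f | exists2 O, schottky_data O & schottky O f] :
    set (prod_topology (fun _ : 'I_n => Homeo0 B))).
Proof.
move=> cM; rewrite openE => f [O dO Sf] /=.
have clc (K : set M) : closed K -> compact K.
  by move=> cK; exact: subclosed_compact cM _.
have [oO _] := dO.
have FF := @nbhs_filter (prod_topology (fun _ : 'I_n => Homeo0 B)) f.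
pose Q i t (g : prod_topology (fun _ : 'I_n => Homeo0 B)) :=
  (t <> Some (i, false) ->
     homeo0_fun (g i) @` closure (O t) `<=` O (Some (i, true))) /\
  (t <> Some (i, true) ->
     homeo0_fun (g i) @` (~` O (Some (i, false))) `<=` ~` closure (O t)).
suff nQ i t : nbhs f (Q i t).
  have : nbhs f [set g | forall i t, Q i t g].
    apply: (@filter_forall _ _ (fun i g => forall t, Q i t g) (nbhs f) FF) => i.
    exact: (@filter_forall _ _ (Q i) (nbhs f) FF (nQ i)).
  by apply: filterS => g Sg; exists O.
have [S1 S2] := Sf i t; apply: filterI.
- have [tn|tn] := pselect (t <> Some (i, false));
    last by apply: (@filterE _ _ FF) => g /tn.
  have H := near_image_sub (homeo0_cts (f := f i))
    (clc _ (@closed_closure _ (O t))) (oO _) (S1 tn).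
  by apply: filterS (near_tuple H) => g + _.
- have [tn|tn] := pselect (t <> Some (i, true));
    last by apply: (@filterE _ _ FF) => g /tn.
  have H := near_image_sub (homeo0_cts (f := f i)) (clc _ (open_closedC (oO _)))
    (closed_openC (@closed_closure _ (O t))) (S2 tn).
  by apply: filterS (near_tuple H) => g + _.
Qed.

End Schottky.

(** * Homeomorphisms supported in a coordinate domain *)

Section Generic.

Lemma continuous2_for (T U V W : topologicalType) (F : U * V -> W)
    (f : T -> U) (g : T -> V) (x : T) :
  {for x, continuous f} -> {for x, continuous g} ->
  {for (f x, g x), continuous F} ->
  {for x, continuous (fun z => F (f z, g z))}.
Proof.
move=> cf cg cF; apply: (continuous_comp (f := fun z => (f z, g z)) _ cF).
exact: (cvg_pair cf cg).
Qed.

Lemma row_continuous_at {R : realType} {d : nat} {T : topologicalType}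
    (f : T -> 'rV[R]_d) (g : 'I_d -> T -> R) (x : T) :
  (forall j y, f y ord0 j = g j y) -> (forall j, {for x, continuous (g j)}) ->
  {for x, continuous f}.
Proof.
move=> fg cg; apply/cvg_ballP => e e0.
have : \forall y \near x, forall j, ball (g j x) e (g j y).
  apply: filter_forall => j; have /cvg_ballP := cg j; exact.
by apply: filterS => y ye; split => // i j; rewrite (ord1 i) !fg.
Qed.

Lemma within_near {T U : topologicalType} (A : set T) (f : T -> U) (x : T)
    (W : set U) : {within A, continuous f} -> A x -> nbhs (f x) W ->
  \forall y \near x, A y -> W (f y).
Proof. by move=> /subspace_continuousP cf Ax; exact: cf. Qed.

Lemma coord_le_norm {R : realType} {d : nat} (y : 'rV[R]_d) j :
  `|y ord0 j| <= `|y|.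
Proof.
have /mapP[i Hi ->] : `|y ord0 j| \in [seq `|y x.1 x.2| | x : 'I_1 * 'I_d].
  by apply/mapP; exists (ord0, j) => //=; rewrite mem_enum.
by rewrite [leRHS]/Num.norm /= mx_normrE; apply/bigmax_geP; right => /=; exists i.
Qed.

Lemma compact_homeomorphism (T U : topologicalType) (f : T -> U) :
  compact [set: T] -> hausdorff_space U -> continuous f -> injective f ->
  (forall y, exists x, f x = y) -> homeomorphism f.
Proof.
move=> cT hU cf fI fS; split=> //.
pose g y := sval (cid (fS y)).
have gK : cancel g f by move=> y; exact: svalP (cid (fS y)).
have fK : cancel f g by move=> x; apply: fI; rewrite gK.
exists g; split => //; apply/continuousP => O oO.
rewrite (_ : g @^-1` O = ~` (f @` (~` O))).
  apply: closed_openC; apply: compact_closed => //.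
  apply: continuous_compact; first exact: continuous_subspaceT.
  by apply: subclosed_compact cT _ => //; exact: open_closedC.
apply/seteqP; split=> [y /= Oy [x nOx xy]|y /= nO].
  by apply: nOx; rewrite -(fK x) xy.
by apply: contrapT => nOy; apply: nO; exists (g y).
Qed.

(** This turns jointly continuous isotopies into paths for uniform convergence: near each [x] the
    estimate holds for all [s] close to [t], and compactness makes it uniform in [x]. *)
Lemma continuous_uniform_curry (T : topologicalType) (M : uniformType)
    (F : T -> M -> M) : compact [set: M] ->
  (forall t x, F z.1 z.2 @[z --> (t, x)] --> F t x) ->
  continuous (F : T -> {uniform M -> M}).
Proof.
move=> /compact_near_coveringP cM cF t P /uniform_nbhs[E [entE EP]].
suff : \forall s \near t, [set: M] `<=` [set x | E (F t x, F s x)].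
  by apply: filterS => s sE; apply: EP => y _; exact: sE.
apply: (cM _ (nbhs t) (fun s x => E (F t x, F s x))) => x _.
have entE' := entourage_split_ent entE.
have := cF t x _ (nbhs_entourage _ (entourage_inv entE')).
have := cF t x _ (nbhs_entourage _ entE').
move=> [[A1 A2] [/= tA1 xA2] A12] [[B1 B2] [/= tB1 xB2] B12].
exists (A2 `&` B2, A1 `&` B1); first by split; exact: filterI.
move=> [y s] /= [[Ay By] [As Bs]].
apply: (entourage_split (F t x)) => //.
  have /xsectionP := B12 (t, y) (conj (nbhs_singleton tB1) By).
  by [].
by have /xsectionP := A12 (s, y) (conj As Ay).
Qed.

End Generic.

(* The values of [h] outside [Omega] and of [k] outside [D] are junk. *)
Definition coords (V M : topologicalType) (D : set V) (Omega : set M)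
    (h : M -> V) (k : V -> M) : Prop :=
  [/\ open Omega, forall x, Omega x -> {for x, continuous h}, continuous k,
      forall y, D y -> Omega (k y) /\ h (k y) = y &
      forall x, Omega x -> D (h x) /\ k (h x) = x].

(** * Radial contractions of a ball *)

Section Radial.
Context {R : realType} {d : nat}.
Implicit Types (v y : 'rV[R]_d) (rho eta : R).

(** For [eta] in (0, 1], the ratio is [eta] up to radius [rho] and 1 from radius [rho + 1] on. It is
    positive and never decreases, so its product with the radius is injective. At [eta = 1] the
    contraction is the identity, so varying [eta] gives an isotopy. *)
Definition sratio rho eta (r : R) : R := Num.min 1 (Num.max eta (r - rho)).

Definition shrink v rho eta y : 'rV[R]_d :=
  v + sratio rho eta `|y - v| *: (y - v).

Lemma sratio_gt0 rho eta r : 0 < eta -> 0 < sratio rho eta r.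
Proof. by move=> e0; rewrite lt_min ltr01 lt_max e0. Qed.

Lemma sratio_le rho eta r s : r <= s -> sratio rho eta r <= sratio rho eta s.
Proof. by move=> rs; apply: le_min2 => //; apply: le_max2 => //; lra. Qed.

Lemma sratio_far rho eta r : rho + 1 <= r -> sratio rho eta r = 1.
Proof. by move=> h; apply/min_idPl; rewrite le_max; apply/orP; right; lra. Qed.

Lemma sratio_near rho eta r : 0 < eta <= 1 -> r <= rho -> sratio rho eta r = eta.
Proof.
move=> /andP[e0 e1] h; rewrite /sratio (max_idPl _); last by lra.
exact/min_idPr.
Qed.

Lemma shrink_far v rho eta y : rho + 1 <= `|y - v| -> shrink v rho eta y = y.
Proof.
by move=> h; rewrite /shrink sratio_far// scale1r addrC subrK.
Qed.

Lemma shrink1 v rho y : shrink v rho 1 y = y.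
Proof.
rewrite /shrink /sratio (min_idPl _) ?scale1r 1?addrC ?subrK//.
by rewrite le_max lexx.
Qed.

Lemma shrink_norm v rho eta y : 0 < eta ->
  `|shrink v rho eta y - v| = sratio rho eta `|y - v| * `|y - v|.
Proof.
by move=> e0; rewrite /shrink addrC addKr normrZ gtr0_norm// sratio_gt0.
Qed.

Lemma sratio_mul_inj rho eta r s : 0 < eta -> 0 <= r -> 0 <= s ->
  sratio rho eta r * r = sratio rho eta s * s -> r = s.
Proof.
move=> e0; wlog rs : r s / r <= s.
  move=> W r_ge0 s_ge0 h; have [/W->//|/ltW/W] := leP r s.
  by move=> <-.
move=> r_ge0 s_ge0 h; apply/eqP; rewrite eq_le rs /= leNgt; apply/negP => rs'.
have := sratio_le rho eta rs; have := sratio_gt0 rho r e0.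
move: h; set a := sratio _ _ _; set b := sratio _ _ _ => h a0 ab.
by nra.
Qed.

Lemma shrink_inj v rho eta : 0 < eta -> injective (shrink v rho eta).
Proof.
move=> e0 y z yz.
have nyz : `|y - v| = `|z - v|.
  apply: (@sratio_mul_inj rho eta) => //.
  by rewrite -!shrink_norm// yz.
move: yz; rewrite /shrink nyz => /addrI.
move=> /(scalerI (lt0r_neq0 (sratio_gt0 rho `|z - v| e0))).
exact: addIr.
Qed.

Lemma sratio_continuous rho : continuous (fun z : R * R => sratio rho z.1 z.2).
Proof.
move=> z; apply: (@continuous_min R _ (fun=> 1)
  (fun z : R * R => Num.max z.1 (z.2 - rho))); first exact: cvg_cst.
apply: (@continuous_max R _ fst (fun z : R * R => z.2 - rho)).
  exact: cvg_fst.
by apply: cvgB; [exact: cvg_snd|exact: cvg_cst].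
Qed.

Lemma shrink_surj v rho eta : 0 < eta ->
  forall z, exists y, shrink v rho eta y = z.
Proof.
move=> e0 z; have [->|zv] := eqVneq z v.
  by exists v; rewrite /shrink subrr scaler0 addr0.
have n0 : 0 < `|z - v| by rewrite normr_gt0 subr_eq0.
pose g r := sratio rho eta r * r.
(* The radius [b] is fixed by [g] and is at least the target, so the intermediate value theorem
   applies on [[0, b]]. *)
pose b := Num.max (rho + 1) `|z - v|.
have gb : g b = b by rewrite /g sratio_far ?mul1r// le_max lexx.
have b0 : 0 <= b by rewrite le_max (ltW n0) orbT.
have [||r /[!in_itv]/= /andP[r_ge0 rb] gr] := @IVT _ g 0 b `|z - v| b0.
- apply: continuous_subspaceT => r; apply: cvgM => //.
  apply: (continuous2_for (F := fun z => sratio rho z.1 z.2)).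
  - exact: cvg_cst.
  - exact: cvg_id.
  - exact: sratio_continuous.
- rewrite /g mulr0 -/(g b) gb (min_idPl _)// (max_idPr _)// normr_ge0 /=.
  by rewrite le_max lexx orbT.
have r1 : 0 < r.
  rewrite lt0r r_ge0 andbT; apply/eqP => rE; move: gr n0.
  by rewrite /g rE mulr0 => <-; rewrite ltxx.
exists (v + (r / `|z - v|) *: (z - v)).
rewrite /shrink.
have -> : v + (r / `|z - v|) *: (z - v) - v = (r / `|z - v|) *: (z - v).
  by rewrite addrAC subrr add0r.
rewrite normrZ normrM normfV normr_id gtr0_norm//.
rewrite divfK ?gt_eqF// scalerA mulrA -/(g r) gr divff ?gt_eqF//.
by rewrite scale1r addrC subrK.
Qed.

Lemma norm_sub_continuous v : continuous (fun y : 'rV[R]_d => `|y - v|).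
Proof. by move=> y; exact: (cvg_norm (cvgB cvg_id (cvg_cst v))). Qed.

Lemma shrink_continuous v rho :
  continuous (fun z : R * 'rV[R]_d => shrink v rho z.1 z.2).
Proof.
move=> z; apply: cvgD; first exact: cvg_cst.
have zv : (fun z : R * 'rV[R]_d => z.2 - v) @ z --> z.2 - v.
  by apply: cvgB; [exact: cvg_snd|exact: cvg_cst].
apply: cvgZ => //.
apply: (@continuous2_for _ _ _ _ (fun z => sratio rho z.1 z.2) fst
  (fun z : R * 'rV[R]_d => `|z.2 - v|)).
- exact: cvg_fst.
- exact: (cvg_norm zv).
- exact: sratio_continuous.
Qed.

End Radial.

(** * Contractions extended to M by the identity *)

Section Support.
Context {R : realType} {d : nat} {M : uniformType} (B : set M).
Context {Omega : set M} {h : M -> 'rV[R]_d} {k : 'rV[R]_d -> M}.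
Hypothesis cM : compact [set: M].
Hypothesis hM : hausdorff_space M.
Hypothesis cO : coords [set: 'rV[R]_d] Omega h k.
Hypothesis OB : Omega `&` B = set0.
Variables (v : 'rV[R]_d) (rho : R).

Definition shrink_ext (eta : R) (x : M) : M :=
  if `[< Omega x >] then k (shrink v rho eta (h x)) else x.

Lemma shrink_extE eta x : Omega x ->
  shrink_ext eta x = k (shrink v rho eta (h x)).
Proof. by move=> Ox; rewrite /shrink_ext asboolT. Qed.

Lemma shrink_ext_out eta x : ~ Omega x -> shrink_ext eta x = x.
Proof. by move=> Ox; rewrite /shrink_ext asboolF. Qed.

Lemma shrink_ext_in eta x : Omega x -> Omega (shrink_ext eta x).
Proof.
by have [_ _ _ kO _] := cO => Ox; rewrite shrink_extE//; apply: (kO _ I).1.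
Qed.

Lemma h_shrink_ext eta x : Omega x ->
  h (shrink_ext eta x) = shrink v rho eta (h x).
Proof.
by have [_ _ _ kO _] := cO => Ox; rewrite shrink_extE//; apply: (kO _ I).2.
Qed.

Lemma shrink_ext_far eta x :
  (Omega x -> rho + 1 <= `|h x - v|) -> shrink_ext eta x = x.
Proof.
have [_ _ _ _ hO] := cO.
have [Ox /(_ Ox) far|nO _] := pselect (Omega x); last exact: shrink_ext_out.
by rewrite shrink_extE// shrink_far// (hO _ Ox).2.
Qed.

Lemma shrink_ext1 x : shrink_ext 1 x = x.
Proof.
have [_ _ _ _ hO] := cO; have [Ox|nO] := pselect (Omega x); last exact: shrink_ext_out.
by rewrite shrink_extE// shrink1 (hO _ Ox).2.
Qed.

(** Inside [Omega] this is read in coordinates. For [x] outside, the points moved by any of the maps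
    lie in the image [Z] of a closed ball, which is compact, hence closed, and misses [x]. *)
Lemma shrink_ext_continuous eta x :
  shrink_ext z.1 z.2 @[z --> (eta, x)] --> shrink_ext eta x.
Proof.
have [oO hc kc kO hO] := cO; have [Ox|nO] := pselect (Omega x).
  have cvgk : k (shrink v rho z.1 (h z.2)) @[z --> (eta, x)] -->
      k (shrink v rho eta (h x)).
    apply: (continuous_comp (f := fun z : R * M => shrink v rho z.1 (h z.2))
      (x := (eta, x)) (g := k)); last exact: kc.
    apply: (continuous2_for (F := fun z => shrink v rho z.1 z.2)).
    - exact: cvg_fst.
    - apply: continuous_comp; first exact: cvg_snd.
      exact: hc.
    - exact: shrink_continuous.
  rewrite (shrink_extE _ Ox); apply: cvg_trans cvgk; apply: near_eq_cvg.
  exists (setT, Omega); first by split; [exact: filterT|exact: open_nbhs_nbhs].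
  by move=> [e y] [/= _ Oy]; rewrite shrink_extE.
pose Z := k @` [set y | `|y - v| <= rho + 1].
have cZ : closed Z.
  apply: compact_closed => //; apply: continuous_compact.
    exact: continuous_subspaceT.
  apply: bounded_closed_compact.
    exists (rho + 1 + `|v|); split; first exact: num_real.
    move=> t tr y /= yv; rewrite (le_trans _ (ltW tr))// -[y in `|y|](subrK v).
    by rewrite (le_trans (ler_normD _ _))// lerD2r.
  rewrite (_ : mkset _ = (fun y => `|y - v|) @^-1` [set r | r <= rho + 1])//.
  apply: closed_comp => [y _|]; last exact: closed_le.
  exact: norm_sub_continuous.
have nZ : ~ Z x by move=> [y _ yx]; apply: nO; rewrite -yx; apply: (kO _ I).1.
rewrite (shrink_ext_out _ nO).
have : (fun z : R * M => z.2) @ (eta, x) --> x by exact: cvg_snd.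
apply: cvg_trans; apply: near_eq_cvg.
exists (setT, ~` Z).
  split; first exact: filterT.
  by apply: open_nbhs_nbhs; split => //; exact: closed_openC.
move=> [e y] [/= _ nZy]; rewrite shrink_ext_far// => Oy.
rewrite leNgt; apply/negP => far; apply: nZy; exists (h y); first exact: ltW.
exact: (hO _ Oy).2.
Qed.

Lemma shrink_ext_inj eta : 0 < eta -> injective (shrink_ext eta).
Proof.
have [_ _ _ _ hO] := cO => e0 x y xy.
have Oxy : Omega x <-> Omega y.
  split=> [Ox|Oy]; apply: contrapT => nO.
    by apply: (nO); rewrite -(shrink_ext_out eta nO) -xy; exact: shrink_ext_in.
  by apply: (nO); rewrite -(shrink_ext_out eta nO) xy; exact: shrink_ext_in.
have [Ox|nOx] := pselect (Omega x); last first.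
  by rewrite -(shrink_ext_out eta nOx) xy shrink_ext_out// => /Oxy.
have Oy := Oxy.1 Ox; rewrite -(hO _ Ox).2 -(hO _ Oy).2; congr k.
by apply: (@shrink_inj _ _ v rho eta) => //; rewrite -!h_shrink_ext// xy.
Qed.

Lemma shrink_ext_surj eta : 0 < eta -> forall z, exists x, shrink_ext eta x = z.
Proof.
have [_ _ _ kO hO] := cO => e0 z.
have [Oz|nOz] := pselect (Omega z); last by exists z; rewrite shrink_ext_out.
have [y yz] := shrink_surj v rho e0 (h z).
exists (k y); rewrite shrink_extE ?(kO _ I).2 ?yz ?(hO _ Oz).2//.
exact: (kO _ I).1.
Qed.

(** Letting the ratio run from [eta] to 1 joins the map to the identity through homeomorphisms
    supported in [Omega], away from [B]. *)
Lemma shrink_ext_homeo0 eta : 0 < eta <= 1 -> homeo0_set B (shrink_ext eta).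
Proof.
move=> /andP[e0 e1].
exists ((shrink_ext : R -> {uniform M -> M}) @` `[eta, 1]); last first.
  by exists eta => //=; rewrite in_itv /= lexx.
split.
- exists 1; first by rewrite /= in_itv /= e1 lexx.
  by apply/funext => x; exact: shrink_ext1.
- move=> _ [t /= + <-]; rewrite in_itv /= => /andP[et _].
  have t0 : 0 < t by exact: lt_le_trans et.
  split; last first.
    move=> x Bx; apply: shrink_ext_out => Ox.
    by have : (Omega `&` B) x by []; rewrite OB.
  apply: compact_homeomorphism => //.
  + move=> x; apply: (continuous_comp (f := fun x => (t, x))
      (g := fun z : R * M => shrink_ext z.1 z.2)).
      exact: (cvg_pair (cvg_cst _) cvg_id).
    exact: shrink_ext_continuous.
  + exact: shrink_ext_inj.
  + exact: shrink_ext_surj.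
- apply: connected_continuous_connected; first exact: segment_connected.
  apply: continuous_subspaceT; apply: continuous_uniform_curry => //.
  by move=> t x; exact: shrink_ext_continuous.
Qed.

End Support.

(** * Shears supported in a slab *)

Section Shear.
Context {R : realType} {d : nat} (i0 i1 : 'I_d) (c delta : R).

Definition tent (y : 'rV[R]_d) : R := Num.max 0 (delta - `|y ord0 i1 - c|).

(** The displacement along [i0] depends only on coordinate [i1], which is preserved when [i0 != i1];
    opposite parameters then give inverse maps. *)
Definition shear (s : R) (y : 'rV[R]_d) : 'rV[R]_d :=
  y + (s * tent y) *: delta_mx ord0 i0.

Lemma tent_continuous : continuous tent.
Proof.
move=> y; apply: (@continuous_max R _ (fun=> 0)
  (fun y : 'rV[R]_d => delta - `|y ord0 i1 - c|) y); first exact: cst_continuous.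
exact: (cvgB (cvg_cst _)
  (cvg_norm (cvgB (@coord_continuous R 1 d ord0 i1 y) (cvg_cst c)))).
Qed.

Lemma shear_continuous s : continuous (shear s).
Proof.
move=> y; apply: (cvgD (@cvg_id _ _)).
by apply: cvgZr_tmp; apply: cvgMl_tmp; exact: tent_continuous.
Qed.

Hypothesis i01 : i0 != i1.

Lemma tent_shear s y : tent (shear s y) = tent y.
Proof.
by rewrite /tent /shear !mxE eqxx /= eq_sym (negbTE i01) mulr0 addr0.
Qed.

Lemma shearK s : cancel (shear s) (shear (- s)).
Proof.
move=> y; rewrite {1}/shear tent_shear /shear -addrA -scalerDl mulNr.
by rewrite subrr scale0r addr0.
Qed.

Lemma shear_id s (y : 'rV[R]_d) : delta <= `|y ord0 i1 - c| -> shear s y = y.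
Proof.
move=> h; rewrite /shear /tent (max_idPl _) ?subr_le0//.
by rewrite mulr0 scale0r addr0.
Qed.

Lemma shear_coord s (y : 'rV[R]_d) : 0 <= delta -> y ord0 i1 = c ->
  shear s y ord0 i0 = y ord0 i0 + s * delta.
Proof.
move=> d0 yc; rewrite /shear /tent yc subrr normr0 subr0 (max_idPr _)//.
by rewrite !mxE !eqxx mulr1.
Qed.

End Shear.

Lemma coords_comp (V V' M : topologicalType) (Omega : set M) (h : M -> V) k
    (s : V -> V') (t : V' -> V) :
  coords [set: V] Omega h k -> continuous s -> continuous t ->
  cancel s t -> cancel t s -> coords [set: V'] Omega (s \o h) (k \o t).
Proof.
move=> [oO hc kc kO hO] cs ct st ts; split => //.
- by move=> x Ox; apply: continuous_comp; [exact: hc|exact: cs].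
- by move=> y; apply: continuous_comp; [exact: ct|exact: kc].
- by move=> y _ /=; have [? ->] := kO (t y) I; rewrite ts.
- by move=> x Ox /=; rewrite st; split => //; exact: (hO _ Ox).2.
Qed.

Section Gather.
Context {R : realType} {d : nat} {M : uniformType} (B : set M).
Context {Omega : set M} {h : M -> 'rV[R]_d} {k : 'rV[R]_d -> M}.
Hypothesis cM : compact [set: M].
Hypothesis hM : hausdorff_space M.
Hypothesis cO : coords [set: 'rV[R]_d] Omega h k.
Hypothesis OB : Omega `&` B = set0.
Variables i0 i1 : 'I_d.
Hypothesis i01 : i0 != i1.

(* A shear pushes [u] far away without moving [K] nor [v], so that a ball
   centred at [v] contains [K] but not [u] and can be shrunk towards [v]. *)
Lemma gather (K : set M) (u v : M) : compact K -> K `<=` Omega ->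
  Omega u -> Omega v ->
  (forall x, K x -> h x ord0 i1 != h u ord0 i1) ->
  h v ord0 i1 != h u ord0 i1 ->
  exists2 U, open_nbhs u U & forall V, nbhs v V -> exists phi : Homeo0 B,
    [/\ homeo0_fun phi @` K `<=` V, forall x, U x -> homeo0_fun phi x = x,
        forall x, ~ Omega x -> homeo0_fun phi x = x &
        forall x, Omega x -> Omega (homeo0_fun phi x)].
Proof.
move=> cK KO Ou Ov Ku vu; have [oO hc kc kO hO] := cO.
pose L := K `|` [set v].
have LO : L `<=` Omega by move=> x [/KO|->].
have cL : compact L by apply: compactU => //; exact: compact_set1.
have chL : {within L, continuous h}.
  apply: continuous_in_subspaceT => x /set_mem/LO; exact: hc.
have cc : {within L, continuous (fun x => h x ord0 i1)}.
  apply: continuous_in_subspaceT => x /set_mem/LO/hc hx.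
  apply: (continuous_comp (g := fun y : 'rV[R]_d => y ord0 i1) hx).
  exact: coord_continuous.
have clL : closed ((fun x => h x ord0 i1) @` L).
  by apply: compact_closed => //; exact: continuous_compact.
(* The gap [delta] in coordinate [i1] between [u] and the compact set [L] is the half-width of a
   slab around [u] in which a shear leaves [L] fixed. *)
have [delta /= delta0 dL] : nbhs (h u ord0 i1) (~` ((fun x => h x ord0 i1) @` L)).
  apply: open_nbhs_nbhs; split; first exact: closed_openC.
  move=> [x Lx xu]; case: Lx xu => [/Ku/eqP|->] //.
  exact/eqP.
have {}dL x : L x -> delta <= `|h x ord0 i1 - h u ord0 i1|.
  move=> Lx; rewrite leNgt; apply/negP => xu.
  by apply: (dL (h x ord0 i1)); [rewrite /ball_ /= distrC|exists x].
have [rho rho0 Krho] : exists2 rho, 0 < rho & forall x, L x -> `|h x - h v| <= rho.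
  have [m [_ mL]] := compact_bounded (continuous_compact chL cL).
  pose m' := Num.max m 0 + 1.
  have mm' : m < m' by rewrite ltr_pwDr// le_max lexx.
  have m'0 : 0 < m' by rewrite ltr_pwDr// le_max lexx orbT.
  have L' x : L x -> `|h x| <= m' by move=> Lx; apply: (mL _ mm'); exists x.
  exists (m' + m') => [|x Lx]; first exact: addr_gt0.
  by rewrite (le_trans (ler_normB _ _))// lerD// L'//; right.
(* The tent has height [delta] at [u], so [u] is translated along [i0] by [rho + 2] plus the initial
   gap, which takes it out of the ball of radius [rho + 1] about [h v]. *)
pose s := (rho + 2 + `|h u ord0 i0 - h v ord0 i0|) / delta.
pose tau := shear i0 i1 (h u ord0 i1) delta s.
pose tau' := shear i0 i1 (h u ord0 i1) delta (- s).
(* The slab is unbounded, so the shear serves as a change of coordinates and not as an element of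
   the group. *)
have cO' : coords [set: 'rV[R]_d] Omega (tau \o h) (k \o tau').
  apply: coords_comp => //; try exact: shear_continuous.
  - exact: shearK.
  - by have := shearK (h u ord0 i1) delta i01 (- s); rewrite opprK.
have tauL x : L x -> tau (h x) = h x by move=> Lx; exact/shear_id/dL.
have tauu : rho + 1 < `|tau (h u) - h v|.
  apply: lt_le_trans (coord_le_norm _ i0).
  rewrite [X in _ < `|X|]mxE [(- h v) _ _]mxE shear_coord ?(ltW delta0)// /s divfK ?gt_eqF//.
  set a := h u ord0 i0; set b := h v ord0 i0.
  have := ler_norm (b - a); rewrite distrC => ab.
  by rewrite ltr_normr; apply/orP; left; lra.
exists (Omega `&` [set x | rho + 1 < `|tau (h x) - h v|]).
  split=> //; rewrite openE => x [Ox xf].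
  have hx : (fun x => `|tau (h x) - h v|) @ x --> `|tau (h x) - h v|.
    have [_ hc' _ _ _] := cO'.
    apply: (continuous_comp (g := fun y : 'rV[R]_d => `|y - h v|) (hc' _ Ox)).
    exact: norm_sub_continuous.
  apply: filterI; first exact: open_nbhs_nbhs.
  apply: (hx [set r | rho + 1 < r]).
  by apply: open_nbhs_nbhs; split => //; exact: open_gt.
move=> V Vv.
have : nbhs (h v) ((k \o tau') @^-1` V).
  have kv : (k \o tau') (h v) = v.
    have [_ _ _ _ /(_ v Ov)[_]] := cO'.
    by rewrite /= tauL//; right.
  have [_ _ kc' _ _] := cO'.
  by apply: kc'; rewrite kv.
rewrite -nbhs_ballE => -[e /= e0 eV].
(* With this ratio the ball of radius [rho] contracts to radius at most [e / 2]. *)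
pose eta := Num.min 1 (e / (2 * rho)).
have eta0 : 0 < eta by rewrite lt_min ltr01 /= divr_gt0// mulr_gt0.
have eta1 : eta <= 1 by rewrite ge_min lexx.
have etae : eta * rho < e.
  rewrite (@le_lt_trans _ _ (e / (2 * rho) * rho))//.
    by rewrite ler_pM2r// ge_min lexx orbT.
  rewrite invfM mulrA divfK ?gt_eqF//; lra.
have etai : 0 < eta <= 1 by rewrite eta0.
exists (mk_homeo0 (shrink_ext_homeo0 cM hM cO' OB (h v) rho etai)).
split.
- move=> _ [x Kx <-]; have Ox := KO _ Kx; have Lx : L x by left.
  rewrite homeo0_fun_mk shrink_extE//; apply: eV.
  rewrite -ball_normE /= tauL// distrC shrink_norm// sratio_near ?Krho//.
  apply: le_lt_trans etae; rewrite ler_pM2l//; exact: Krho.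
- by move=> x [Ox xf]; apply: (shrink_ext_far cO') => _; exact: ltW.
- by move=> x nO; exact: shrink_ext_out.
- by move=> x Ox; exact: (shrink_ext_in cO').
Qed.

End Gather.

(** * Coordinates on a manifold with boundary *)

Section SetHomeomorphism.
Context {T U : topologicalType} (A : set T) (B : set U).

(** Total functions continuous within the sets are easier to restrict and compose than maps of
    subspace types. The point [a0] supplies the values outside [A] and [B]. *)
Lemma homeomorphic_setP (a0 : T) : A a0 -> homeomorphic A B ->
  exists (F : T -> U) (G : U -> T),
    [/\ forall x, A x -> B (F x) /\ G (F x) = x,
        forall y, B y -> A (G y) /\ F (G y) = y,
        {within A, continuous F} & {within B, continuous G}].
Proof.
move=> Aa0 [f [cf [g [cg fK gK]]]].
pose F x := if pselect (A x) is left Ax then set_val (f (SigSub (mem_set Ax)))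
  else set_val (f (SigSub (mem_set Aa0))).
pose G y := if pselect (B y) is left By then set_val (g (SigSub (mem_set By)))
  else a0.
have FE (x : A) : F (set_val x) = set_val (f x).
  rewrite /F; case: pselect => [Ax|nA]; last by case: nA; exact: set_valP.
  by congr (set_val (f _)); exact: val_inj.
have GE (y : B) : G (set_val y) = set_val (g y).
  rewrite /G; case: pselect => [By|nB]; last by case: nB; exact: set_valP.
  by congr (set_val (g _)); exact: val_inj.
exists F, G; split.
- move=> x Ax; have -> : x = set_val (SigSub (mem_set Ax) : A) by [].
  by rewrite FE GE fK; split => //; exact: set_valP.
- move=> y By; have -> : y = set_val (SigSub (mem_set By) : B) by [].
  by rewrite GE FE gK; split => //; exact: set_valP.
- apply/subspace_sigL_continuousP.
  rewrite (_ : sigL A F = set_val \o f); last exact/funext.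
  by move=> x; apply: continuous_comp; [exact: cf|exact: initial_continuous].
- apply/subspace_sigL_continuousP.
  rewrite (_ : sigL B G = set_val \o g); last exact/funext.
  by move=> x; apply: continuous_comp; [exact: cg|exact: initial_continuous].
Qed.

Lemma homeomorphic_set (F : T -> U) (G : U -> T) :
  (forall x, A x -> B (F x) /\ G (F x) = x) ->
  (forall y, B y -> A (G y) /\ F (G y) = y) ->
  {within A, continuous F} -> {within B, continuous G} -> homeomorphic A B.
Proof.
move=> AF BG /subspace_sigL_continuousP cF /subspace_sigL_continuousP cG.
pose f (x : A) : B := SigSub (mem_set (AF (set_val x) (set_valP x)).1).
pose g (y : B) : A := SigSub (mem_set (BG (set_val y) (set_valP y)).1).
exists f; split; first exact: (@continuous_comp_initial _ _ _ set_val f cF).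
exists g; split.
- exact: (@continuous_comp_initial _ _ _ set_val g cG).
- by move=> x; apply/val_inj; exact: (AF (set_val x) (set_valP x)).2.
- by move=> x; apply/val_inj; exact: (BG (set_val x) (set_valP x)).2.
Qed.

End SetHomeomorphism.

(** * Open boxes as copies of the whole space *)

Section Box.
Context {R : realType} {d : nat}.
Implicit Types (s t : R) (y z w : 'rV[R]_d).

(** A homeomorphism from the line onto (-1, 1). As it preserves signs, applying it to each
    coordinate also matches the half space with half a box. *)
Definition squeeze s : R := s / (1 + `|s|).
Definition unsqueeze t : R := t / (1 - `|t|).

Lemma squeeze_lt1 s : `|squeeze s| < 1.
Proof.
have h : 0 < 1 + `|s| by rewrite ltr_pwDl.
by rewrite normrM normfV (gtr0_norm h) ltr_pdivrMr// mul1r ltrDr.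
Qed.

Lemma squeezeK : cancel squeeze unsqueeze.
Proof.
move=> s; have h : 0 < 1 + `|s| by rewrite ltr_pwDl.
rewrite /unsqueeze /squeeze normrM normfV (gtr0_norm h).
have -> : 1 - `|s| / (1 + `|s|) = (1 + `|s|)^-1.
  by rewrite -{1}(divff (lt0r_neq0 h))// -mulrBl addrK mul1r.
by rewrite invrK divfK// gt_eqF.
Qed.

Lemma unsqueezeK t : `|t| < 1 -> squeeze (unsqueeze t) = t.
Proof.
move=> t1; have h : 0 < 1 - `|t| by rewrite subr_gt0.
rewrite /unsqueeze /squeeze normrM normfV (gtr0_norm h).
have -> : 1 + `|t| / (1 - `|t|) = (1 - `|t|)^-1.
  by rewrite -{1}(divff (lt0r_neq0 h))// -mulrDl subrK mul1r.
by rewrite invrK divfK// gt_eqF.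
Qed.

Lemma squeeze_ge0 s : (0 <= squeeze s) = (0 <= s).
Proof. by rewrite /squeeze pmulr_lge0// invr_gt0 ltr_pwDl. Qed.

Lemma squeeze_continuous : continuous squeeze.
Proof.
move=> s; apply: cvgM; first exact: cvg_id.
apply: cvgV; first by rewrite gt_eqF// ltr_pwDl.
exact: (cvgD (cvg_cst _) (cvg_norm cvg_id)).
Qed.

Lemma unsqueeze_continuous t : `|t| < 1 -> {for t, continuous unsqueeze}.
Proof.
move=> t1; apply: cvgM; first exact: cvg_id.
apply: cvgV; first by rewrite gt_eqF// subr_gt0.
exact: (cvgB (cvg_cst _) (cvg_norm cvg_id)).
Qed.

Definition to_box y (r : R) z : 'rV[R]_d := y + r *: map_mx squeeze z.
Definition of_box y (r : R) w : 'rV[R]_d := map_mx unsqueeze (r^-1 *: (w - y)).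

Lemma to_boxE y r z j : to_box y r z ord0 j = y ord0 j + r * squeeze (z ord0 j).
Proof. by rewrite !mxE. Qed.

Lemma of_boxE y r w j :
  of_box y r w ord0 j = unsqueeze (r^-1 * (w ord0 j - y ord0 j)).
Proof. by rewrite !mxE. Qed.

Lemma ball_rowP y r w : 0 < r ->
  ball y r w <-> forall j, `|y ord0 j - w ord0 j| < r.
Proof.
move=> r0; split=> [[_ yw] j|yw]; first exact: yw.
by split => // i j; rewrite (ord1 i); exact: yw.
Qed.

Lemma to_box_ball y r z : 0 < r -> ball y r (to_box y r z).
Proof.
move=> r0; apply/ball_rowP => // j; rewrite to_boxE opprD addrA subrr sub0r.
by rewrite normrN normrM gtr0_norm// gtr_pMr// squeeze_lt1.
Qed.

Lemma to_boxK y r : 0 < r -> cancel (to_box y r) (of_box y r).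
Proof.
move=> r0 z; apply/rowP => j; rewrite of_boxE to_boxE addrAC subrr add0r.
by rewrite mulKf ?gt_eqF// squeezeK.
Qed.

Lemma of_boxK y r w : 0 < r -> ball y r w -> to_box y r (of_box y r w) = w.
Proof.
move=> r0 /(ball_rowP _ _ r0) yw; apply/rowP => j; rewrite to_boxE of_boxE.
rewrite unsqueezeK; first by rewrite mulVKf ?gt_eqF// addrC subrK.
by rewrite normrM normfV (gtr0_norm r0) mulrC ltr_pdivrMr// mul1r distrC.
Qed.

Lemma to_box_continuous y r : continuous (to_box y r).
Proof.
move=> z; apply: (row_continuous_at (fun j z => to_boxE y r z j)) => j.
have c : (fun z : 'rV[R]_d => squeeze (z ord0 j)) @ z --> squeeze (z ord0 j).
  apply: (continuous_comp (f := fun z : 'rV[R]_d => z ord0 j)).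
    exact: coord_continuous.
  exact: squeeze_continuous.
exact: (cvgD (cvg_cst _) (cvgMl_tmp c)).
Qed.

Lemma of_box_continuous y r w : 0 < r -> ball y r w ->
  {for w, continuous (of_box y r)}.
Proof.
move=> r0 /(ball_rowP _ _ r0) yw.
apply: (row_continuous_at (fun j w => of_boxE y r w j)) => j.
apply: (continuous_comp (f := fun w : 'rV[R]_d => r^-1 * (w ord0 j - y ord0 j))).
  exact: (cvgMl_tmp (cvgB (@coord_continuous R 1 d ord0 j w) (cvg_cst _))).
apply: unsqueeze_continuous.
by rewrite normrM normfV (gtr0_norm r0) mulrC ltr_pdivrMr// mul1r distrC.
Qed.

(** Precomposing with this retraction extends a continuous map of the half space to the whole space,
    since [coords] asks for a total continuous [k]. *)
Definition half_retract z : 'rV[R]_d :=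
  \row_j (if val j == 0%N then Num.max 0 (z ord0 j) else z ord0 j).

Lemma half_retract_half z : half_space R d (half_retract z).
Proof. by move=> j j0; rewrite mxE j0 eqxx le_max lexx. Qed.

Lemma half_retract_id z : half_space R d z -> half_retract z = z.
Proof.
move=> hz; apply/rowP => j; rewrite mxE; case: eqP => // /hz z0.
exact/max_idPr.
Qed.

Lemma half_retract_continuous : continuous half_retract.
Proof.
move=> z; apply: row_continuous_at => [j y|j]; first by rewrite mxE.
move=> /=; case: eqP => _; last exact: coord_continuous.
apply: (@continuous_max R _ (fun=> 0) (fun z : 'rV[R]_d => z ord0 j) z).
  exact: cst_continuous.
exact: coord_continuous.
Qed.

End Box.

Section ManifoldCoords.
Context {R : realType} {d : nat} {M : topologicalType}.

(** The chart is cut down to the box of radius [r] about [y], then rescaled; [P] retracts the whole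
    space onto the model [D]. *)
Lemma coords_of_retract (U : set M) F (G : 'rV[R]_d -> M)
    (D : set 'rV[R]_d) P (y : 'rV[R]_d) r (S : set 'rV[R]_d) :
  open U -> (forall x, U x -> S (F x) /\ G (F x) = x) ->
  (forall y, S y -> U (G y) /\ F (G y) = y) ->
  {within U, continuous F} -> {within S, continuous G} -> 0 < r ->
  (forall z, D (P z)) -> (forall z, D z -> P z = z) -> continuous P ->
  (forall z, D z <-> S (to_box y r z)) ->
  coords D (U `&` F @^-1` ball y r) (of_box y r \o F) (G \o to_box y r \o P).
Proof.
move=> oU UF SG cF cG r0 DP PD cP DS.
have cF' : {in U, continuous F} by rewrite -continuous_open_subspace.
split.
- by apply: (continuous_inP _ oU).1 => //; exact: ball_open.
- move=> x [Ux bx]; apply: continuous_comp; first exact/cF'/mem_set.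
  exact: of_box_continuous.
- move=> z W /= GW; have /DS SP := DP z.
  have c : {for z, continuous (to_box y r \o P)}.
    by apply: continuous_comp; [exact: cP|exact: to_box_continuous].
  have : nbhs z (fun z' => S (to_box y r (P z')) -> W (G (to_box y r (P z')))).
    exact: c (within_near cG SP GW).
  by apply: filterS => z'; apply; exact/DS.
- move=> z Dz; rewrite /= PD//; have [UG FG] := SG _ ((DS z).1 Dz).
  split; first by split => //=; rewrite FG; exact: to_box_ball.
  by rewrite FG to_boxK.
- move=> x [Ux bx] /=; have [SF GF] := UF _ Ux.
  have Dx : D (of_box y r (F x)) by apply/DS; rewrite of_boxK.
  by rewrite PD// of_boxK.
Qed.

(** If the coordinate of index 0 vanishes at [x], a small box meets the half space in half a box.
    Otherwise, or if there is no such coordinate, a small box lies inside the half space. *)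
Lemma manifold_coords (x : M) (N : set M) : manifold R d M -> nbhs x N ->
  (exists Omega (h : M -> 'rV[R]_d) k,
    [/\ coords [set: 'rV[R]_d] Omega h k, Omega x & Omega `<=` N]) \/
  (exists Omega (h : M -> 'rV[R]_d) k, exists2 i0 : 'I_d, val i0 = 0%N &
    [/\ coords (half_space R d) Omega h k, Omega x, Omega `<=` N &
        h x ord0 i0 = 0]).
Proof.
move=> [_ _ /(_ x)[U [V [oU Ux oV UV]]]] Nx.
have [F [G [UF VG cF cG]]] := homeomorphic_setP Ux UV.
have [[VFx HFx] GFx] := UF _ Ux.
have : nbhs (F x) (fun w => (V `&` half_space R d) w -> N (G w)).
  by apply: (within_near cG) => //; rewrite GFx.
move=> nG; have : nbhs (F x) V by exact: open_nbhs_nbhs.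
move=> /(filterI nG); rewrite -nbhs_ballE => -[r /= r0 rV].
have sub r' : 0 < r' -> r' <= r ->
    U `&` F @^-1` ball (F x) r' `<=` N.
  move=> r'0 r'r w [Uw /= Fw]; have [SF GF] := UF _ Uw.
  by have [/(_ SF)] := rV _ (le_ball r'r Fw); rewrite GF.
have [[i0 [i00 Fi0]]|no0] := pselect (exists i0 : 'I_d, val i0 = 0%N /\ F x ord0 i0 = 0).
  right; exists (U `&` F @^-1` ball (F x) r), (of_box (F x) r \o F),
    (G \o to_box (F x) r \o half_retract); exists i0 => //.
  split.
  - apply: (@coords_of_retract U F G _ _ _ _ (V `&` half_space R d)) => //.
    + exact: half_retract_half.
    + exact: half_retract_id.
    + exact: half_retract_continuous.
    + move=> z; split=> [zH|[_ zH] j j0].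
        split; first exact: (rV _ (to_box_ball _ _ r0)).2.
        move=> j j0; have -> : j = i0 by apply: val_inj; rewrite /= j0 i00.
        by rewrite to_boxE Fi0 add0r pmulr_rge0// squeeze_ge0; exact: zH.
      have ji0 : j = i0 by apply: val_inj; rewrite /= j0 i00.
      have := zH j j0; rewrite to_boxE ji0 Fi0 add0r pmulr_rge0//.
      by rewrite squeeze_ge0.
  - by split => //; exact: ballxx.
  - exact: sub.
  - by rewrite /= of_boxE subrr mulr0 /unsqueeze mul0r.
left.
have [r' [r'0 r'r r'H]] : exists r', [/\ 0 < r', r' <= r &
    ball (F x) r' `<=` half_space R d].
  have [[i0 i00]|noi] := pselect (exists i0 : 'I_d, val i0 = 0%N); last first.
    by exists r; split => // w _ j j0; case: noi; exists j.
  have Fi0 : 0 < F x ord0 i0.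
    rewrite lt0r HFx// andbT; apply/eqP => F0; apply: no0.
    by exists i0.
  exists (Num.min r (F x ord0 i0)); split; rewrite ?lt_min ?r0 ?ge_min ?lexx//.
  move=> w /ball_rowP; rewrite lt_min r0 Fi0 => /(_ isT i0).
  rewrite lt_min => /andP[_ wi] j j0.
  have -> : j = i0 by apply: val_inj; rewrite /= j0 i00.
  by have := ler_norm (F x ord0 i0 - w ord0 i0); lra.
exists (U `&` F @^-1` ball (F x) r'), (of_box (F x) r' \o F),
  (G \o to_box (F x) r' \o id).
split.
- apply: (@coords_of_retract U F G _ _ _ _ (V `&` half_space R d)) => //.
    exact: (fun z => @cvg_id _ (nbhs z)).
  move=> z; split=> // _; have b := to_box_ball (F x) z r'0.
  by split; [exact: (rV _ (le_ball r'r b)).2|exact: r'H].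
- by split => //; exact: ballxx.
- exact: sub.
Qed.

Lemma coords_interior Omega (h : M -> 'rV[R]_d) k :
  coords [set: 'rV[R]_d] Omega h k -> Omega `&` boundary R d M = set0.
Proof.
move=> [oO hc kc kO hO]; apply/seteqP; split => // x [Ox nint]; apply: nint.
exists Omega, setT; split => //; first exact: openT.
apply: (homeomorphic_set (F := h) (G := k)) => //.
- by apply: continuous_in_subspaceT => y /set_mem; exact: hc.
- exact: continuous_subspaceT.
Qed.

Lemma boundary_coords (x : M) (N : set M) : manifold R d M ->
  boundary R d M x -> nbhs x N ->
  exists Omega (h : M -> 'rV[R]_d) k, exists2 i0 : 'I_d, val i0 = 0%N &
    [/\ coords (half_space R d) Omega h k, Omega x, Omega `<=` N &
        h x ord0 i0 = 0].
Proof.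
move=> mM xb /(manifold_coords mM)[|//] [Omega [h [k [/coords_interior O0 Ox _]]]].
by have : (Omega `&` boundary R d M) x by []; rewrite O0.
Qed.

(* A box touching the boundary hyperplane is homeomorphic to the whole space. *)
Lemma collar_coords (x : M) (N : set M) : manifold R d M ->
  boundary R d M x -> nbhs x N ->
  exists Omega (h : M -> 'rV[R]_d) k,
    [/\ coords [set: 'rV[R]_d] Omega h k, Omega `<=` N & nbhs x (closure Omega)].
Proof.
move=> mM xb /(boundary_coords mM xb)[Om [h [k [i0 i00 [cO Ox ON hx0]]]]].
have [oO hc kc kO hO] := cO.
have i0P (j : 'I_d) : val j = 0%N -> j = i0.
  by move=> j0; apply: val_inj; rewrite /= i00.
pose e : 'rV[R]_d := delta_mx ord0 i0.
(* The box of radius 1 about [c] lies in the open half space, and [h x] is the centre of one of its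
   faces. *)
pose c := h x + e.
have eE j : e ord0 j = (j == i0)%:R by rewrite mxE.
have cE j : c ord0 j = h x ord0 j + (j == i0)%:R by rewrite mxE eE.
exists (Om `&` h @^-1` ball c 1), (of_box c 1 \o h), (k \o to_box c 1 \o id).
split.
- apply: (@coords_of_retract Om h k _ _ _ _ (half_space R d)) => //.
  + by apply: continuous_in_subspaceT => y /set_mem; exact: hc.
  + exact: continuous_subspaceT.
  + exact: (fun z => @cvg_id _ (nbhs z)).
  + move=> z; split=> // _ j /i0P ->; rewrite to_boxE cE hx0 eqxx mul1r.
    have := squeeze_lt1 (z ord0 i0); have := ler_norm (- squeeze (z ord0 i0)).
    by rewrite normrN mulr1n; lra.
- by move=> y [Oy _]; exact: ON.
have nx : nbhs x (Om `&` h @^-1` ball (h x) 1).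
  apply: filterI; first exact: open_nbhs_nbhs.
  by apply: (hc _ Ox); exact: nbhsx_ballx.
(* Each such [w] is a limit of points of the new domain, obtained by pushing it inwards along [e]. A
   step below 1 keeps the coordinate [i0] strictly between 0 and 2. *)
apply: filterS nx => w [Ow /= hw] A Aw.
have [Hw kw] := hO _ Ow.
have ck : (fun t : R => k (h w + t *: e)) @ (0 : R) --> k (h w + 0 *: e).
  apply: (continuous_comp (f := fun t : R => h w + t *: e)); last exact: kc.
  by apply: cvgD; [exact: cvg_cst|apply: cvgZr_tmp; exact: cvg_id].
have : nbhs (0 : R) (fun t => A (k (h w + t *: e))).
  by apply: ck; rewrite scale0r addr0 kw.
rewrite -nbhs_ballE => -[r /= r0 rA].
pose t := Num.min (r / 2) (1 / 2).
have t0 : 0 < t by rewrite lt_min !divr_gt0.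
have tr : t < r by rewrite gt_min; apply/orP; left; lra.
have t1 : t < 1 by rewrite gt_min; apply/orP; right; lra.
have wE j : (h w + t *: e) ord0 j = h w ord0 j + t * (j == i0)%:R.
  by rewrite mxE [X in _ + X]mxE eE.
have Hwt : half_space R d (h w + t *: e).
  move=> j j0; have := Hw j j0; rewrite wE.
  by case: (_ == _); rewrite ?mulr1n ?mulr0n; lra.
exists (k (h w + t *: e)); split; last first.
  by apply: rA; rewrite /ball /= sub0r normrN gtr0_norm.
have [Ok hk] := kO _ Hwt; split => //=; rewrite hk.
apply/ball_rowP => // j; move/(ball_rowP _ _ ltr01): hw => /(_ j).
rewrite cE wE; have [->|ji] := eqVneq j i0; last first.
  by rewrite mulr0n mulr0 !addr0.
have := Hw _ i00; rewrite hx0 sub0r normrN => h0; rewrite ger0_norm// => h1.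
by rewrite ltr_norml; apply/andP; split; rewrite mulr1n; lra.
Qed.

End ManifoldCoords.

(** * Density *)

Section GenericPoints.
Context {R : realType} {M : topologicalType} {I : finType}.
Context (W : set M) (F : I -> M -> R).
Hypothesis oW : open W.
Hypothesis cF : forall i x, W x -> {for x, continuous (F i)}.
Hypothesis F_nonconstant : forall i (O : set M) c,
  open O -> O !=set0 -> O `<=` W -> exists2 x, O x & F i x <> c.

Lemma generic_point (O : set M) (s : seq (I * R)) :
  open O -> O !=set0 -> O `<=` W ->
  exists2 x, O x & forall p, p \in s -> F p.1 x <> p.2.
Proof.
elim: s O => [|p s IH] O oO O0 OW; first by case: O0 => x Ox; exists x.
have [|||x [Ox xp] xs] := IH (O `&` F p.1 @^-1` (~` [set p.2])).
- apply: (continuous_inP (F p.1) oO).1; last exact/closed_openC/closed_eq.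
  by move=> x /set_mem/OW; exact: cF.
- by have [x Ox xp] := F_nonconstant p.1 p.2 oO O0 OW; exists x.
- by move=> x [/OW].
by exists x => // q /[!inE] /predU1P[->|/xs].
Qed.

(** Each new point avoids the finitely many values taken at the earlier ones. Different functions
    are compared too, because a point must also be separated from the images of the others. *)
Lemma generic_points (J : finType) :
  W !=set0 -> exists a : J -> M, (forall j, W (a j)) /\
    forall i i' j j', j != j' -> F i (a j) != F i' (a j').
Proof.
move=> W0; have [x0 Wx0] := W0.
suff : forall s : seq J, uniq s -> exists a : J -> M, (forall j, W (a j)) /\
    forall i i' j j', j \in s -> j' \in s -> j != j' -> F i (a j) != F i' (a j').
  move=> /(_ (enum J) (enum_uniq _))[a [aW aF]]; exists a; split => // *.
  by apply: aF; rewrite ?mem_enum.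
elim=> [_|j0 s IH /= /andP[js us]]; first by exists (fun=> x0).
have [a [aW aF]] := IH us.
pose values := [seq F q (a j) | q <- enum I, j <- s].
have [x Wx xF] := @generic_point W [seq (i, c) | i <- enum I, c <- values]
  oW W0 (@subset_refl _ _).
have neq i i' j : j \in s -> F i x != F i' (a j).
  move=> js'; apply/eqP; apply: (xF (i, F i' (a j))).
  apply/allpairsP; exists (i, F i' (a j)); rewrite mem_enum; split => //=.
  by apply/allpairsP; exists (i', j); rewrite mem_enum.
exists (fun j => if j == j0 then x else a j); split; first by move=> j; case: ifP.
move=> i i' j j'; rewrite !inE.
have [->|_ /= jl] := eqVneq j j0; have [->|_ /= jl'] := eqVneq j' j0.
- by [].
- by move=> js' _; exact: neq.
- by move=> _ _; rewrite eq_sym; exact: neq.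
- exact: aF.
Qed.

End GenericPoints.

Section Perturbation.
Context {M : uniformType} (B : set M) {n : nat}.

(** The filter of uniformly close tuples converges to [f], as is checked on each factor of the
    product. *)
Lemma near_tuple_entourage (f : prod_topology (fun _ : 'I_n => Homeo0 B))
    (A : set (prod_topology (fun _ : 'I_n => Homeo0 B))) : nbhs f A ->
  exists2 E, entourage E & forall g : 'I_n -> Homeo0 B,
    (forall i x, E (homeo0_fun (f i) x, homeo0_fun (g i) x)) -> A g.
Proof.
pose near_f E := [set g : 'I_n -> Homeo0 B |
  forall i x, E (homeo0_fun (f i) x, homeo0_fun (g i) x)].
pose G : set_system (prod_topology (fun _ : 'I_n => Homeo0 B)) :=
  filter_from entourage near_f.
have FG : Filter G.
  apply: filter_from_filter; first by exists setT; exact: entourageT.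
  move=> E1 E2 e1 e2; exists (E1 `&` E2); first exact: filterI.
  by move=> g gE; split=> i x; case: (gE i x).
suff : G --> f by move=> Gf /Gf[E entE EA]; exists E => // g gE; exact: EA.
apply/cvg_sup => i P.
rewrite nbhsE => -[_ [[C [C' oC' <-] <-] C'f] CP].
have : nbhs (homeo0_fun (f i) : {uniform M -> M}) C' by exact: open_nbhs_nbhs.
move=> /uniform_nbhs[E [entE EC']]; exists E => // g gE.
by apply: CP; apply: EC' => x _; exact: gE.
Qed.

End Perturbation.

Section Density.
Context {R : realType} {d : nat} {M : uniformType}.
Hypothesis mM : manifold R d M.
Hypothesis cM : compact [set: M].
Variables i0 i1 : 'I_d.
Hypothesis i01 : i0 != i1.
Let B := boundary R d M.
Variable p : M.
Hypothesis Bp : B p.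

(** A small move along the axis [i1] stays in [O] and changes the value. *)
Lemma coord_nonconstant (Omega : set M) (h : M -> 'rV[R]_d) k (O : set M) c :
  coords [set: 'rV[R]_d] Omega h k -> open O -> O !=set0 -> O `<=` Omega ->
  exists2 x, O x & h x ord0 i1 <> c.
Proof.
move=> [oO hc kc kO hO] oO' [x Ox] OO.
have [xc|] := pselect (h x ord0 i1 = c); last by exists x.
pose g (t : R) := k (h x + t *: delta_mx ord0 i1).
have cg : g @ (0 : R) --> g 0.
  apply: (continuous_comp (f := fun t : R => h x + t *: delta_mx ord0 i1));
    last exact: kc.
  by apply: cvgD; [exact: cvg_cst|apply: cvgZr_tmp; exact: cvg_id].
have : nbhs (0 : R) (g @^-1` O).
  apply: cg; rewrite /g scale0r addr0 (hO _ (OO _ Ox)).2.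
  exact: open_nbhs_nbhs.
rewrite -nbhs_ballE => -[e /= e0 eO]; exists (g (e / 2)).
  by apply: eO; rewrite /ball /= sub0r normrN gtr0_norm ?divr_gt0//; lra.
rewrite /g (kO _ I).2 !mxE !eqxx xc mulr1 => /eqP.
by rewrite -subr_eq0 addrAC subrr add0r gt_eqF// divr_gt0.
Qed.

Lemma homeo0_boundary (f : Homeo0 B) : homeo0_fun f p = p.
Proof. by have [_] := homeo0_homeo (homeo0P f); apply. Qed.

(* The images of a small open set near [p] under the [f i] are open and contained
   in the closure of [Omega], hence can be assumed to lie in [Omega]. *)
Lemma common_domain (n : nat) (f : 'I_n -> Homeo0 B) (Omega : set M) :
  open Omega -> nbhs p (closure Omega) ->
  exists W, [/\ open W, W !=set0, W `<=` Omega &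
    forall i, homeo0_fun (f i) @` W `<=` Omega].
Proof.
move=> oO Op.
pose Q := (closure Omega)° `&` [set x | forall i, (closure Omega)° (homeo0_fun (f i) x)].
have pQ : nbhs p Q.
  apply: filterI; first exact: nbhs_interior.
  apply: (@filter_forall _ _ _ (nbhs p) _) => i.
  apply: homeo0_cts; rewrite homeo0_boundary; exact: nbhs_interior.
suff [W [oW W0 WOQ WO]] : exists W, [/\ open W, W !=set0, W `<=` Omega `&` Q &
    forall i, i \in enum 'I_n -> homeo0_fun (f i) @` W `<=` Omega].
  exists W; split => // [x /WOQ[]//|i]; apply: WO; exact: mem_enum.
elim: (enum 'I_n) => [|i s [W [oW [w Ww] WOQ WO]]].
  exists (Omega `&` Q°); split => //.
  - by apply: openI => //; exact: open_interior.
  - have := nbhs_singleton Op; apply.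
    exact: nbhs_interior.
  - by move=> x [Ox /interior_subset].
exists (W `&` homeo0_fun (f i) @^-1` Omega); split.
- apply: openI => //; apply: open_comp => // x _; exact: homeo0_cts.
- have [_ [_ /(_ i)/interior_subset]] := WOQ _ Ww.
  move=> /(_ (homeo0_fun (f i) @` W)) [].
    apply: open_nbhs_nbhs; split; last by exists w.
    exact: homeo0_open.
  by move=> z [Oz [y Wy yz]]; exists y; split => //=; rewrite yz.
- by move=> x [/WOQ].
- move=> j /[!inE] /predU1P[->|js] _ [x [Wx fx] <-] //.
  by apply: (WO _ js); exists x.
Qed.

(** The new map is [phi2^-1 * phi1 * f i]. Here [phi1] gathers near [v] the images of all pieces but
    the one of [tm], and fixes a neighbourhood of [u]; [phi2] gathers near [u] all pieces but the
    one of [tp], and fixes a neighbourhood of [v]. *)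
Lemma schottky_near (n : nat) (f : 'I_n -> Homeo0 B) (E : set (M * M)) :
  entourage E -> exists g : 'I_n -> Homeo0 B,
    (forall i x, E (homeo0_fun (f i) x, homeo0_fun (g i) x)) /\
    exists2 O, schottky_data O & schottky O g.
Proof.
move=> entE; have hM : hausdorff_space M by have [] := mM.
have clc (K : set M) : closed K -> compact K.
  by move=> clK; exact: subclosed_compact cM _.
pose E' := split_ent E.
have entE' : entourage E' by exact: entourage_split_ent.
(* Any two points of [N] are [E]-close through [p], so changes that keep [Omega] inside itself are
   within the allowed error. *)
pose N := xsection E' p `&` [set x | E' (x, p)].
have pN : nbhs p N.
  apply: filterI; first exact: nbhs_entourage.
  apply: filterS (nbhs_entourage p (entourage_inv entE')) => x.
  by move=> /xsectionP.
have [Omega [h [k [cO ON pO]]]] := collar_coords mM Bp pN.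
have EO x y : Omega x -> Omega y -> E (x, y).
  move=> /ON[_ xp] /ON[/xsectionP py _].
  exact: (entourage_split p).
have [oO hc kc kO hO] := cO.
have [W [oW W0 WO fWO]] := common_domain f oO pO.
(* The index [None] stands for the identity, so the points are separated together with their
   images. *)
pose F (i : option 'I_n) x := h (oapp (fun i => homeo0_fun (f i)) id i x) ord0 i1.
have Fc i x : W x -> {for x, continuous (F i)}.
  case: i => [i|] Wx.
    apply: (continuous_comp (f := homeo0_fun (f i))
      (g := fun y => h y ord0 i1)); first exact: homeo0_cts.
    apply: (continuous_comp (g := fun y : 'rV[R]_d => y ord0 i1)).
      by apply: hc; apply: fWO; exists x.
    exact: coord_continuous.
  apply: (continuous_comp (g := fun y : 'rV[R]_d => y ord0 i1)).
    exact/hc/WO.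
  exact: coord_continuous.
have Fnc i (O : set M) c : open O -> O !=set0 -> O `<=` W ->
    exists2 x, O x & F i x <> c.
  case: i => [i|] oO' O0 OW; last first.
    by apply: (coord_nonconstant c cO) => // x /OW/WO.
  have [|||_ [x Ox <-] xc] := @coord_nonconstant _ _ _ (homeo0_fun (f i) @` O) c cO.
  - exact: homeo0_open.
  - by have [x Ox] := O0; exists (homeo0_fun (f i) x); exists x.
  - by move=> _ [x /OW Wx <-]; apply: fWO; exists x.
  - by exists x.
have [a [aW aF]] := generic_points oW Fc Fnc (option ('I_n * bool)) W0.
(* The points are thickened to pieces: the finitely many inequalities at [a t] persist nearby, and
   regularity extends them to a closure. *)
have : forall t, exists O : set M, [/\ open O, O (a t), closure O `<=` W &
    forall x i i' t', closure O x -> t' != t -> F i x != F i' (a t')].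
  move=> t; pose Q := [set x | forall q : option 'I_n * (option 'I_n * option ('I_n * bool)),
    q.2.2 != t -> F q.1 x != F q.2.1 (a q.2.2)].
  have : nbhs (a t) (W `&` Q).
    apply: filterI; first exact: open_nbhs_nbhs.
    apply: (@filter_forall _ _ _ (nbhs (a t)) _) => -[i [i' t']] /=.
    have [->|t't] := eqVneq t' t; first exact: nearW.
    have nF : nbhs (F i (a t)) (~` [set F i' (a t')]).
      apply: open_nbhs_nbhs; split; first exact/closed_openC/closed_eq.
      by apply/eqP; apply: aF; rewrite eq_sym.
    have : nbhs (a t) (F i @^-1` (~` [set F i' (a t')])).
      exact: (Fc i (a t) (aW t) _ nF).
    by apply: filterS => x /eqP.
  move=> /uniform_regular[V aV VWQ]; exists V°; split.
  - exact: open_interior.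
  - exact: aV.
  - by move=> x /(closureS (@interior_subset _ V))/VWQ[].
  - by move=> x i i' t' /(closureS (@interior_subset _ V))/VWQ[_ Qx] t't;
      exact: (Qx (i, (i', t'))).
move=> /choice[O OP].
have oOt t : open (O t) by have [] := OP t.
have clO (S : set (option ('I_n * bool))) : closed (\bigcup_(t in S) closure (O t)).
  by apply: closed_bigcup => [|t _]; [exact: finite_finset|exact: closed_closure].
have : forall i, exists g : Homeo0 B,
    (forall x, E (homeo0_fun (f i) x, homeo0_fun g x)) /\
    forall t, (t <> Some (i, false) ->
      homeo0_fun g @` closure (O t) `<=` O (Some (i, true))) /\
    (t <> Some (i, true) ->
      homeo0_fun g @` (~` O (Some (i, false))) `<=` ~` closure (O t)).
  move=> i; set tm := Some (i, false); set tp := Some (i, true).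
  have WP t x : closure (O t) x -> W x by have [_ _ + _] := OP t; apply.
  have FP x j j' t' t : closure (O t) x -> t' != t -> F j x != F j' (a t').
    by have [_ _ _ +] := OP t; apply.
  have Oa t : O t (a t) by have [] := OP t.
  pose L t0 := \bigcup_(t in [set t | t <> t0]) closure (O t).
  pose K1 := homeo0_fun (f i) @` L tm.
  pose u := homeo0_fun (f i) (a tm); pose v := a tp.
  have cK1 : compact K1.
    apply: continuous_compact (clc _ (clO _)).
    by apply: continuous_subspaceT; exact: homeo0_cts.
  have Ou : Omega u by apply: fWO; exists (a tm).
  have Ov : Omega v by apply: WO; exact: aW.
  have K1O : K1 `<=` Omega.
    by move=> _ [x [t _ /WP Wx] <-]; apply: fWO; exists x.
  have K2O : L tp `<=` Omega by move=> x [t _ /WP /WO].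
  have K1u x : K1 x -> h x ord0 i1 != h u ord0 i1.
    move=> [y [t tm' Oy] <-].
    by apply: (FP y (Some i) (Some i) tm t) => //; rewrite eq_sym; apply/eqP.
  have K2v x : L tp x -> h x ord0 i1 != h v ord0 i1.
    move=> [t tp' Ox].
    by apply: (FP x None None tp t) => //; rewrite eq_sym; apply/eqP.
  have vu : h v ord0 i1 != h u ord0 i1 by apply: (aF None (Some i) tp tm); apply/eqP.
  have OB := coords_interior cO.
  have [U1 [oU1 U1u] G1] := gather cM hM cO OB i01 cK1 K1O Ou Ov K1u vu.
  have uv : h u ord0 i1 != h v ord0 i1 by rewrite eq_sym.
  have [U2 [oU2 U2v] G2] := gather cM hM cO OB i01 (clc _ (clO _)) K2O Ov Ou K2v uv.
  (* Both [U1] and [U2] are known before either map is chosen, so each map can gather its compact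
     set where the other is the identity. *)
  have [|phi1 [phi1K phi1U phi1n phi1O]] := G1 (U2 `&` O tp).
    by apply: open_nbhs_nbhs; split; [exact: openI|].
  have [|phi2 [phi2K phi2U phi2n phi2O]] := G2 (U1 `&` homeo0_fun (f i) @` O tm).
    apply: open_nbhs_nbhs; split; first by apply: openI => //; exact: homeo0_open.
    by split => //; exists (a tm).
  exists (phi2^-1 * phi1 * f i)%g; split=> [x|t].
    (* Either [y] is outside [Omega] and stays fixed, or both [y] and its image lie in [Omega]. *)
    rewrite !homeo0_funM; set y := homeo0_fun (f i) x.
    have [Oy|nOy] := pselect (Omega y); last first.
      rewrite phi1n// -{2}(phi2n y)// homeo0_funVK.
      exact: entourage_refl.
    apply: EO => //; apply: contrapT => nO; have := phi2n _ nO.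
    rewrite homeo0_funKV => phiy; apply: nO; rewrite -phiy; exact: phi1O.
  split=> tn.
    move=> _ [x Ox <-]; rewrite !homeo0_funM.
    have [] : (U2 `&` O tp) (homeo0_fun phi1 (homeo0_fun (f i) x)).
      apply: phi1K; exists (homeo0_fun (f i) x) => //.
      by exists x => //; exists t.
    set z := homeo0_fun phi1 _ => U2z Oz.
    by rewrite -(phi2U z)// homeo0_funVK.
  (* If [z] were in the closure of [O t], then [phi2 z] would be in [U1], where [phi1] is the
     identity, so it would equal [f i x] and put [x] in [O tm]. *)
  move=> _ [x nOx <-]; rewrite !homeo0_funM; set z := homeo0_fun _^-1%g _ => Oz.
  have phi2z : homeo0_fun phi2 z = homeo0_fun phi1 (homeo0_fun (f i) x).
    by rewrite homeo0_funKV.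
  have [] : (U1 `&` homeo0_fun (f i) @` O tm) (homeo0_fun phi2 z).
    by apply: phi2K; exists z => //; exists t.
  rewrite phi2z => U1z [y Oy].
  rewrite (can_inj (homeo0_funVK phi1) (phi1U _ U1z)).
  by move=> /(can_inj (homeo0_funVK (f i))) yx; apply: nOx; rewrite -yx.
move=> /choice[g gP]; exists g; split; first by move=> i; exact: (gP i).1.
exists O; last by move=> i t; exact: (gP i).2.
split => //; exists (a None); split; first by have [] := OP None.
move=> s Os; have [_ _ _ OsF] := OP (Some s).
by have := OsF (a None) None None None Os isT; rewrite eqxx.
Qed.

End Density.

(** * Dimension one *)

Section OneDim.
Context {R : realType} {M : topologicalType}.
Hypothesis hM : hausdorff_space M.

Let nonneg : set R := [set s | 0 <= s].

(** The supremum of the points of [P] up to [y] belongs to [P] by closedness. *)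
Lemma last_exit (P : set R) (x y : R) : closed P -> P x -> x <= y -> ~ P y ->
  exists c, [/\ x <= c, c < y, P c & forall s, c < s -> s <= y -> ~ P s].
Proof.
move=> cP Px xy nPy; pose Q := P `&` [set s | s <= y].
have Q0 : Q !=set0 by exists x.
have ubQ : has_ubound Q by exists y => s [].
have cQ : closed Q by apply: closedI => //; exact: closed_le.
have [Pc cy] : Q (sup Q) by apply: cQ; exact: closure_sup.
exists (sup Q); split => //.
- exact: ub_le_sup.
- by rewrite lt_neqAle cy andbT; apply/eqP => cyE; apply: nPy; rewrite -cyE.
- by move=> s cs sy Ps; move: cs; rewrite ltNge (ub_le_sup ubQ).
Qed.

(** * Rays and their ends *)

Section Ray.
Context {A : set M} {alpha : M -> R} {a : R -> M}.
Hypothesis rA : coords nonneg A alpha a.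

Definition tends (q : M) := forall W, nbhs q W ->
  exists N, forall r, N <= r -> W (a r).

Lemma ray_initial_closed (N : R) : closed (a @` `[0, N]).
Proof.
have [_ _ ca _ _] := rA; apply: compact_closed => //.
by apply: continuous_compact; [exact: continuous_subspaceT|exact: segment_compact].
Qed.

(* Outside [A], the parameter of the ray blows up. *)
Lemma ray_escape (q : M) (N : R) : ~ A q ->
  \forall x \near q, A x -> N < alpha x.
Proof.
move=> nA; have [oA _ _ aA Aa] := rA.
have : nbhs q (~` (a @` `[0, N])).
  apply: open_nbhs_nbhs; split; first exact/closed_openC/ray_initial_closed.
  move=> [r /=]; rewrite in_itv /= => /andP[r0 _] aq.
  by apply: nA; rewrite -aq; exact: (aA _ r0).1.
apply: filterS => x nx Ax; rewrite ltNge; apply/negP => xN; apply: nx.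
have [al0 axE] := Aa _ Ax; exists (alpha x) => //=.
by rewrite in_itv /= xN andbT.
Qed.

(** By [ray_escape], [q'] is approached by points of the ray with arbitrarily large parameter, and
    these converge to [q]. *)
Lemma ray_limit_closure (q q' : M) :
  tends q -> closure A q' -> ~ A q' -> q' = q.
Proof.
move=> tq clq' nA; have [oA _ _ aA Aa] := rA.
apply: contrapT => neq; apply: neq; apply: hM => W' W W'q' Wq.
have [N NW] := tq _ Wq.
have [x [Ax [W'x xN]]] := clq' _ (filterI W'q' (ray_escape N nA)).
exists x; split => //; rewrite -(Aa _ Ax).2; apply: NW; apply: ltW; exact: xN.
Qed.

Lemma tends_unique (q q' : M) : tends q -> tends q' -> q = q'.
Proof.
move=> tq tq'; apply: hM => W W' /tq[N NW] /tq'[N' NW'].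
by exists (a (Num.max N N')); split; [apply: NW|apply: NW']; rewrite le_max lexx ?orbT.
Qed.

(** Otherwise [A] would be compact and [alpha] bounded on it, although it takes every nonnegative
    value. *)
Lemma ray_not_closed : compact [set: M] -> A !=set0 ->
  exists q, closure A q /\ ~ A q.
Proof.
move=> cM A0; have [oA hal ca aA Aa] := rA.
apply: contrapT => nq.
have clA : closed A by move=> x clx; apply: contrapT => nAx; apply: nq; exists x.
have cA : compact A by exact: subclosed_compact cM _.
have cal : {within A, continuous alpha}.
  by apply: continuous_in_subspaceT => x /set_mem; exact: hal.
have [m [_ mA]] := compact_bounded (continuous_compact cal cA).
pose m' := Num.max m 0 + 1.
have mm' : m < m' by rewrite ltr_pwDr// le_max lexx.
have m'0 : 0 <= m' by apply: addr_ge0 => //; rewrite le_max lexx orbT.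
have [Am aam] := aA (m' + 1) (addr_ge0 m'0 ler01).
have := mA _ mm' (m' + 1); rewrite /= ger0_norm ?(addr_ge0 m'0 ler01)//.
by move=> /(_ (ex_intro2 _ _ _ Am aam)); lra.
Qed.

Section Curve.
Context (b : R -> M) (c y : R).
Hypotheses (cb : continuous b) (cy : c < y) (nAc : ~ A (b c)).
Hypothesis bA : forall s, c < s -> s <= y -> A (b s).

(** Along the curve, [alpha] blows up as [s] decreases to [c]. By the intermediate value theorem it
    takes every value above [alpha (b s1)], so the curve covers the whole end of the ray. *)
Lemma ray_tail (s1 : R) : c < s1 -> s1 <= y ->
  exists N, forall r, N <= r -> exists s, [/\ c < s, s <= s1 & a r = b s].
Proof.
move=> cs1 s1y; have [oA hal ca aA Aa] := rA.
exists (alpha (b s1)) => r rN.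
have : nbhs c [set s | A (b s) -> r < alpha (b s)].
  exact: cb (ray_escape r nAc).
rewrite -nbhs_ballE => -[e /= e0 er].
pose s2 := Num.min s1 (c + e / 2).
have s2c : c < s2 by rewrite lt_min cs1 ltrDl divr_gt0.
have s21 : s2 <= s1 by rewrite ge_min lexx.
have s2e : s2 <= c + e / 2 by rewrite ge_min lexx orbT.
have rs2 : r < alpha (b s2).
  apply: er; first by rewrite /ball /= ltr_distlC; apply/andP; split; lra.
  by apply: bA => //; lra.
have [||s] := @IVT _ (alpha \o b) s2 s1 r s21.
- apply: continuous_in_subspaceT => s /set_mem /=; rewrite in_itv /= => /andP[s2s ss1].
  apply: continuous_comp; first exact: cb.
  by apply: hal; apply: bA; lra.
- rewrite /= ge_min rN orbT le_max (ltW rs2) //.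
rewrite in_itv /= => /andP[s2s ss1] sr.
have As : A (b s) by apply: bA; lra.
exists s; split; [lra|by []|].
by rewrite -sr (Aa _ As).2.
Qed.

Lemma ray_tends : tends (b c).
Proof.
move=> W /cb; rewrite -[nbhs _ _]/(nbhs c (b @^-1` W)) -nbhs_ballE => -[e /= e0 eW].
pose s1 := Num.min y (c + e / 2).
have s1c : c < s1 by rewrite lt_min cy ltrDl divr_gt0.
have s1y : s1 <= y by rewrite ge_min lexx.
have s1e : s1 <= c + e / 2 by rewrite ge_min lexx orbT.
have [N NP] := ray_tail s1c s1y; exists N => r /NP[s [cs ss1 ->]].
by apply: eW; rewrite /ball /= ltr_distlC; apply/andP; split; lra.
Qed.

End Curve.

Section Line.
Context {I : set M} {beta : M -> R} {b : R -> M}.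
Hypothesis lI : coords [set: R] I beta b.

(** Wherever the line enters [A], the ray tends to the entry point. The ray has only one limit and
    [b] is injective, so the line enters at [c] only; leaving [A] after [z] would be another entry
    for the reversed line. *)
Lemma ray_right (c z : R) : closure A (b c) -> ~ A (b c) -> c < z -> A (b z) ->
  [/\ forall s, c < s -> A (b s), tends (b c) &
    exists N, forall r, N <= r -> exists2 s, c < s & a r = b s].
Proof.
move=> clc nAc cz Abz; have [oI hbe cb bI Ib] := lI; have [oA _ _ _ _] := rA.
have binj : injective b.
  by move=> s t st; rewrite -(bI s Logic.I).2 st (bI t Logic.I).2.
have clP (g : R -> M) : continuous g -> closed (~` (g @^-1` A)).
  by move=> cg; apply: open_closedC; apply: open_comp => // s _; exact: cg.
have right w : c < w -> A (b w) ->
    (forall s, c < s -> s <= w -> A (b s)) /\ tends (b c).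
  move=> cw Abw; have [|c0 [cc0 c0w nA0 A0]] :=
    @last_exit _ c w (clP b cb) nAc (ltW cw); first exact.
  have {}A0 s : c0 < s -> s <= w -> A (b s).
    by move=> c0s sw; apply: contrapT; exact: A0.
  have t0 := ray_tends cb c0w nA0 A0.
  by have /binj -> := ray_limit_closure t0 clc nAc.
have [Az tc] := right z cz Abz.
split => //; last first.
  have [N NP] := ray_tail cb nAc Az cz (lexx z).
  by exists N => r /NP[s [cs _ rs]]; exists s.
move=> w cw; have [wz|zw] := leP w z; first exact: Az.
apply: contrapT => nAw; pose b' s := b (- s).
have cb' : continuous b'.
  by move=> s; apply: continuous_comp; [exact: cvgN|exact: cb].
have [|||c0 [wc0 c0z nA0 A0]] := @last_exit _ (- w) (- z) (clP b' cb').
- by rewrite /= /b' opprK.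
- by rewrite lerN2 ltW.
- by rewrite /= /b' opprK => /(_ Abz).
have {}A0 s : c0 < s -> s <= - z -> A (b' s).
  by move=> c0s sw; apply: contrapT; exact: A0.
have t0 := ray_tends cb' c0z nA0 A0.
have := binj _ _ (tends_unique t0 tc); lra.
Qed.

End Line.

(** The chart is reversed if it meets [A] on the left of [q]. It cannot meet [A] on both sides,
    since each side would contain the end of the ray. *)
Lemma ray_line (I : set M) (beta : M -> R) (b : R -> M) (q : M) :
  coords [set: R] I beta b -> I q -> closure A q -> ~ A q ->
  exists beta' b', coords [set: R] I beta' b' /\ tends q /\
    exists2 c, b' c = q & forall s, A (b' s) <-> c < s.
Proof.
move=> lI Iq clq nAq; have [oI hbe cb bI Ib] := lI.
have line_opp g k : coords [set: R] I g k -> coords [set: R] I (-%R \o g) (k \o -%R).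
  by move=> gk; apply: coords_comp gk _ _ opprK opprK => s; exact: cvgN.
have oriented g k c z : coords [set: R] I g k -> k c = q -> c < z -> A (k z) ->
    tends q /\ forall s, A (k s) <-> c < s.
  move=> gk kcq cz Az; move: clq nAq; rewrite -kcq => clc nAc.
  have [kA tc [N NP]] := ray_right gk clc nAc cz Az.
  split=> // s; split=> [As|/kA//].
  rewrite ltNge; apply/negP => sc.
  have {}sc : s < c by rewrite lt_neqAle sc andbT; apply/eqP => sE; apply: nAc; rewrite -sE.
  have [||||_ _ [N' NP']] := @ray_right _ _ _ (line_opp _ _ gk) (- c) (- s).
  - by rewrite /= opprK.
  - by rewrite /= opprK.
  - by rewrite ltrN2.
  - by rewrite /= opprK.
  have [|s1 cs1 as1] := NP (Num.max N N'); first by rewrite le_max lexx.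
  have [|s2 cs2 as2] := NP' (Num.max N N'); first by rewrite le_max lexx orbT.
  have [_ _ _ kI _] := gk.
  have : s1 = - s2 by rewrite -(kI s1 Logic.I).2 -as1 as2 /= (kI (- s2) Logic.I).2.
  lra.
have [x [Ax Ix]] := clq _ (open_nbhs_nbhs (conj oI Iq)).
have bq : b (beta q) = q := (Ib _ Iq).2.
have [_ bx] := Ib _ Ix.
have [lt|gt|eq] := ltgtP (beta q) (beta x).
- have [tq P] := oriented _ _ _ _ lI bq lt (eq_ind_r A Ax bx).
  by exists beta, b; split => //; split => //; exists (beta q).
- have bq' : (b \o -%R) (- beta q) = q by rewrite /= opprK.
  have [||tq P] := oriented _ _ _ (- beta x) (line_opp _ _ lI) bq'.
  + by rewrite ltrN2.
  + by rewrite /= opprK bx.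
  exists (-%R \o beta), (b \o -%R); split; first exact: line_opp.
  by split => //; exists (- beta q).
- by case: nAq; rewrite -bq eq bx.
Qed.

(** The last exit parameter also gives a limit of the ray, so it must be 0. *)
Lemma ray_half_line (I : set M) (beta : M -> R) (b : R -> M) :
  coords nonneg I beta b -> closure A (b 0) -> ~ A (b 0) ->
  tends (b 0) /\ exists2 y, 0 < y & forall s, 0 < s -> s <= y -> A (b s).
Proof.
move=> lI cl0 nA0; have [oI hbe cb bI Ib] := lI; have [oA _ _ _ _] := rA.
have I0 : I (b 0) := (bI 0 (lexx 0)).1.
have [x [Ax Ix]] := cl0 _ (open_nbhs_nbhs (conj oI I0)).
have [x0 bx] := Ib _ Ix.
have clP : closed (~` (b @^-1` A)).
  by apply: open_closedC; apply: open_comp => // s _; exact: cb.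
have [|c0 [c0_ge0 c0x nAc0 Ac0]] := @last_exit _ 0 (beta x) clP nA0 x0.
  by rewrite /= bx.
have {}Ac0 s : c0 < s -> s <= beta x -> A (b s).
  by move=> c0s sw; apply: contrapT; exact: Ac0.
have t0 := ray_tends cb c0x nAc0 Ac0.
have b0 := ray_limit_closure t0 cl0 nA0.
have c00 : c0 = 0 by rewrite -(bI c0 c0_ge0).2 -b0 (bI 0 (lexx 0)).2.
by rewrite b0; split => //; exists (beta x); rewrite -c00.
Qed.

(** * Prolonging a ray beyond its end *)

Section Glue.
Variables (e : M -> R) (g : R -> M).

(** The ray is reparametrised by [0, 1), which leaves the parameters from 1 on for its limit and
    what follows, described by [e] and [g]. *)
Definition glue_chart (x : M) : R :=
  if `[< A x >] then alpha x / (1 + alpha x) else e x.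

Definition glue_path (r : R) : M := if r < 1 then a (r / (1 - r)) else g r.

Lemma glue_chartE x : A x -> glue_chart x = alpha x / (1 + alpha x).
Proof. by move=> Ax; rewrite /glue_chart asboolT. Qed.

Lemma glue_chart_out x : ~ A x -> glue_chart x = e x.
Proof. by move=> nAx; rewrite /glue_chart asboolF. Qed.

Lemma glue_chart_itv x : A x -> 0 <= glue_chart x < 1.
Proof.
have [_ _ _ _ Aa] := rA => Ax; have := (Aa _ Ax).1; rewrite /nonneg /= => al0.
rewrite glue_chartE// divr_ge0 ?addr_ge0//= ltr_pdivrMr ?ltr_pwDl//.
by rewrite mul1r ltrDr.
Qed.

Lemma glue_chartK x : A x -> glue_path (glue_chart x) = x.
Proof.
have [_ _ _ _ Aa] := rA => Ax; have [] := Aa _ Ax; rewrite /nonneg /= => al0 ax.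
have /andP[_ lt1] := glue_chart_itv Ax.
rewrite /glue_path lt1 glue_chartE// -[RHS]ax; congr a.
have h : 1 + alpha x != 0 by rewrite gt_eqF// ltr_pwDl.
have -> : 1 - alpha x / (1 + alpha x) = (1 + alpha x)^-1.
  by rewrite -{1}(divff h) -mulrBl addrK mul1r.
by rewrite invrK divfK.
Qed.

Lemma glue_pathK r : 0 <= r < 1 ->
  A (glue_path r) /\ glue_chart (glue_path r) = r.
Proof.
have [_ _ _ aA _] := rA => /andP[r0 r1].
have h : 1 - r != 0 by rewrite gt_eqF// subr_gt0.
have r_ge0 : 0 <= r / (1 - r) by rewrite divr_ge0// subr_ge0 ltW.
have [Ar alr] := aA _ r_ge0.
rewrite /glue_path r1 glue_chartE// alr; split => //.
have -> : 1 + r / (1 - r) = (1 - r)^-1 by rewrite -{1}(divff h) -mulrDl subrK mul1r.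
by rewrite invrK divfK.
Qed.

Lemma glue_chart_continuous_in x : A x -> {for x, continuous glue_chart}.
Proof.
have [oA hal _ _ Aa] := rA => Ax.
have al0 : 0 <= alpha x := (Aa _ Ax).1.
have c : (fun x => alpha x / (1 + alpha x)) @ x --> alpha x / (1 + alpha x).
  apply: cvgM; first exact: hal.
  apply: cvgV; first by rewrite gt_eqF// ltr_pwDl.
  exact: (cvgD (cvg_cst _) (hal _ Ax)).
rewrite /prop_for /continuous_at glue_chartE//; apply: cvg_trans c.
apply: near_eq_cvg; apply: filterS (open_nbhs_nbhs (conj oA Ax)) => y Ay.
by rewrite glue_chartE.
Qed.

Lemma glue_chart_continuous_end q : ~ A q -> e q = 1 -> {for q, continuous e} ->
  {for q, continuous glue_chart}.
Proof.
have [_ _ _ _ Aa] := rA => nAq eq1 ce.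
apply/cvg_ballP => eps eps0; rewrite glue_chart_out// eq1.
have : \forall x \near q, ball (1 : R) eps (e x) by have /cvg_ballP := ce; rewrite eq1; exact.
apply: filterS2 (ray_escape eps^-1 nAq) => x xe ex.
have [Ax|nAx] := pselect (A x); last by rewrite glue_chart_out.
have al0 : 0 <= alpha x := (Aa _ Ax).1.
rewrite glue_chartE// /ball /=.
have h : 0 < 1 + alpha x by rewrite ltr_pwDl.
have -> : 1 - alpha x / (1 + alpha x) = (1 + alpha x)^-1.
  by rewrite -{1}(divff (lt0r_neq0 h)) -mulrBl addrK mul1r.
rewrite gtr0_norm ?invr_gt0// -[ltRHS]invrK ltf_pV2 ?posrE ?invr_gt0//.
by have := xe Ax; lra.
Qed.

Lemma glue_path_continuous_lt r : r < 1 -> {for r, continuous glue_path}.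
Proof.
have [_ _ ca _ _] := rA => r1.
have c : (fun r => a (r / (1 - r))) @ r --> a (r / (1 - r)).
  apply: (continuous_comp (f := fun r : R => r / (1 - r))); last exact: ca.
  apply: cvgM; first exact: cvg_id.
  apply: cvgV; first by rewrite gt_eqF// subr_gt0.
  exact: (cvgB (cvg_cst _) cvg_id).
rewrite /prop_for /continuous_at /glue_path r1; apply: cvg_trans c.
apply: near_eq_cvg; have : nbhs r [set s | s < 1].
  by apply: open_nbhs_nbhs; split => //; exact: open_lt.
by apply: filterS => s /= ->.
Qed.

Lemma glue_path_continuous :
  continuous g -> tends (g 1) -> continuous glue_path.
Proof.
move=> cg tg r; have [r1|r1|->] := ltgtP r 1; first exact: glue_path_continuous_lt.
  have c := cg r.
  rewrite /continuous_at /glue_path ltNge (ltW r1) /=; apply: cvg_trans c.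
  apply: near_eq_cvg; have : nbhs r [set s | 1 < s].
    by apply: open_nbhs_nbhs; split => //; exact: open_gt.
  by apply: filterS => s /= s1; rewrite ltNge (ltW s1).
move=> W; rewrite /glue_path ltxx => gW; have [N NW] := tg _ gW.
have : nbhs (1 : R) (g @^-1` W) by exact: cg.
(* The truncation at 0 makes [1 + N'] positive; then [N' / (1 + N') < s < 1] forces [s / (1 - s)]
   above [N']. *)
pose N' := Num.max N 0.
have N'0 : 0 <= N' by rewrite le_max lexx orbT.
have n1 : nbhs (1 : R) [set s | N' / (1 + N') < s].
  apply: open_nbhs_nbhs; split; first exact: open_gt.
  by rewrite /= ltr_pdivrMr ?ltr_pwDl// mul1r ltrDr.
apply: filterS2 n1 => s /= Ns gs; case: ltP => // s1; apply: NW.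
apply: (@le_trans _ _ N'); first by rewrite le_max lexx.
rewrite ler_pdivlMr ?subr_gt0//; move: Ns; rewrite ltr_pdivrMr ?ltr_pwDl//.
nra.
Qed.

End Glue.

End Ray.

Lemma ray_extend (A : set M) alpha a (I : set M) beta b (q : M) :
  coords nonneg A alpha a -> coords [set: R] I beta b -> I q ->
  closure A q -> ~ A q ->
  exists alpha' a', coords nonneg (A `|` I) alpha' a'.
Proof.
move=> rA lI0 Iq clq nAq.
have [beta' [b' [lI [tq [c bc Ab]]]]] := ray_line rA lI0 Iq clq nAq.
have [oA hal ca aA Aa] := rA; have [oI hbe cb bI Ib] := lI.
(* The ray occupies the part of the line beyond [c], so the prolongation runs backwards, passing
   through [q] at parameter 1. *)
pose e x := c + 1 - beta' x; pose g r := b' (c + 1 - r).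
have g1 : g 1 = q by rewrite /g addrK.
have ce x : I x -> {for x, continuous e}.
  by move=> Ix; exact: (cvgB (cvg_cst _) (hbe _ Ix)).
have cg : continuous g.
  move=> r; apply: continuous_comp; last exact: cb.
  exact: (cvgB (cvg_cst _) cvg_id).
have IA x : I x -> A x <-> c < beta' x.
  by move=> Ix; rewrite -Ab (Ib _ Ix).2.
exists (glue_chart (A := A) (alpha := alpha) e), (glue_path (a := a) g); split.
- exact: openU.
- move=> x AIx; have [Ax|nAx] := pselect (A x).
    exact: (glue_chart_continuous_in rA).
  have Ix : I x by case: AIx.
  have [cx|xc|xc] := ltgtP c (beta' x); first by case: nAx; apply/IA.
    have : {for x, continuous e} by exact: ce.
    rewrite /prop_for /continuous_at glue_chart_out//; apply: cvg_trans.
    apply: near_eq_cvg; have := hbe _ Ix [set s | s < c].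
    move=> /(_ (open_nbhs_nbhs (conj (@open_lt _ c) xc))).
    apply: filterS2 (open_nbhs_nbhs (conj oI Ix)) => y Iy /= yc.
    by rewrite glue_chart_out// => /(IA _ Iy); rewrite ltNge (ltW yc).
  apply: (glue_chart_continuous_end rA) => //; last exact: ce.
  by rewrite /e -xc addrAC subrr add0r.
- by apply: (glue_path_continuous rA) => //; rewrite g1.
- move=> r r0; have [r1|r1] := ltP r 1.
    have [|Ar gr] := @glue_pathK _ _ _ rA e g r; first by rewrite r0.
    by split => //; left.
  have nA : ~ A (b' (c + 1 - r)) by rewrite Ab; lra.
  rewrite /glue_path ltNge r1 /= glue_chart_out// /e /g (bI _ Logic.I).2.
  by split; [right; exact: (bI _ Logic.I).1|lra].
- move=> x AIx; have [Ax|nAx] := pselect (A x).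
    have /andP[x0 _] := glue_chart_itv rA e Ax.
    by split => //; exact: glue_chartK.
  have Ix : I x by case: AIx.
  have xc : beta' x <= c by rewrite leNgt; apply/negP => /(IA _ Ix).
  rewrite glue_chart_out// /glue_path; have -> : (e x < 1) = false.
    by apply/negbTE; rewrite -leNgt /e; lra.
  split; first by rewrite /nonneg /= /e; lra.
  rewrite /g (_ : c + 1 - e x = beta' x) ?(Ib _ Ix).2//.
  by rewrite /e; lra.
Qed.

(** Adding the endpoint gives [C], a copy of [0, 1], hence connected. It is open, because the half
    line near [q] lies in [A], and closed, because it is the closure of [A]; so it is the component
    of [p]. *)
Lemma ray_finish (A : set M) alpha a (I : set M) beta b (p : M) :
  coords nonneg A alpha a -> coords nonneg I beta b ->
  closure A (b 0) -> ~ A (b 0) -> A p ->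
  homeomorphic (connected_component [set: M] p) [set` `[(0 : R), 1]].
Proof.
move=> rA lI clq nAq Ap; set q := b 0 in clq nAq.
have [tq [y y0 yA]] := ray_half_line rA lI clq nAq.
have [oA hal ca aA Aa] := rA; have [oI hbe cb bI Ib] := lI.
pose F := glue_chart (A := A) (alpha := alpha) (fun=> 1).
pose G := glue_path (a := a) (fun=> q).
have cG : continuous G by apply: (glue_path_continuous rA) => // s; exact: cvg_cst.
pose C := A `|` [set q].
have FC x : C x -> `[(0 : R), 1]%classic (F x) /\ G (F x) = x.
  move=> [Ax|->].
    rewrite /= in_itv /=; have /andP[-> /ltW ->] := glue_chart_itv rA (fun=> 1) Ax.
    by split => //; exact: glue_chartK.
  by rewrite /F glue_chart_out// /G /glue_path ltxx /= in_itv /= lexx ler01.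
have GC r : `[(0 : R), 1]%classic r -> C (G r) /\ F (G r) = r.
  rewrite /= in_itv /= => /andP[r0 r1]; have [lt|ge] := ltP r 1.
    have [|Ar Fr] := @glue_pathK _ _ _ rA (fun=> 1) (fun=> q) r; first by rewrite r0.
    by split => //; left.
  have -> : r = 1 by apply/eqP; rewrite eq_le r1.
  by rewrite /G /glue_path ltxx /F glue_chart_out//; split => //; right.
have cF x : C x -> {for x, continuous F}.
  move=> [Ax|->]; first exact: (glue_chart_continuous_in rA).
  by apply: (glue_chart_continuous_end rA) => //; exact: cst_continuous.
have oC : open C.
  rewrite openE => x [Ax|->].
    by apply: filterS (open_nbhs_nbhs (conj oA Ax)) => z Az; left.
  have [Iq bq] := bI 0 (lexx 0).
  have : nbhs q (I `&` beta @^-1` [set s | s < y]).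
    apply: filterI; first exact: open_nbhs_nbhs.
    apply: (hbe _ Iq); rewrite bq.
    by apply: open_nbhs_nbhs; split => //; exact: open_lt.
  apply: filterS => z [Iz /= zy]; have [] := Ib _ Iz; rewrite /nonneg /= => z0 <-.
  have [z0'|z0'] := ltP 0 (beta z); first by left; apply: yA => //; exact: ltW.
  by right; rewrite /q; congr b; apply/eqP; rewrite eq_le z0' z0.
have clC : closed C.
  have -> : C = closure A.
    apply/seteqP; split=> [x [/subset_closure//|->//]|x clx].
    have [Ax|nAx] := pselect (A x); [by left|right].
    exact: (ray_limit_closure rA tq).
  exact: closed_closure.
have CG : C = G @` `[0, 1].
  apply/seteqP; split=> [x /FC[Fx Gx]|_ [r /GC[Cr _] <-]] //.
  by exists (F x).
have cC : connected C.
  rewrite CG; apply: connected_continuous_connected; first exact: segment_connected.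
  exact: continuous_subspaceT.
have -> : connected_component [set: M] p = C.
  have Cp : C p by left.
  apply/seteqP; split; last by apply: connected_component_max.
  have pc : connected_component [set: M] p p by exact: connected_component_refl.
  have <- : connected_component [set: M] p `&` C = connected_component [set: M] p.
    apply: (@component_connected _ [set: M] p).
    - by exists p.
    - by exists C.
    - by exists C.
  exact: subIsetr.
apply: (homeomorphic_set FC GC).
- by apply: continuous_in_subspaceT => x /set_mem; exact: cF.
- exact: continuous_subspaceT.
Qed.

(** The logarithm identifies the positive half line with the line. *)
Lemma half_line_interior (I : set M) beta b : coords nonneg I beta b ->
  coords [set: R] (I `&` beta @^-1` [set s | 0 < s]) (@ln R \o beta) (b \o @expR R).
Proof.
move=> [oI hbe cb bI Ib]; split.
- apply: (continuous_inP beta oI).1; last exact: open_gt.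
  by move=> x /set_mem; exact: hbe.
- move=> x [Ix /= x0]; apply: continuous_comp; first exact: hbe.
  exact: continuous_ln.
- by move=> s; apply: continuous_comp; [exact: continuous_expR|exact: cb].
- move=> s _; have [] := bI (expR s) (expR_ge0 s) => Is bs.
  by rewrite /= bs expRK expR_gt0.
- by move=> x [Ix /= x0]; rewrite lnK ?posrE// (Ib _ Ix).2.
Qed.

Lemma coords_row1 (D : set 'rV[R]_1) (Omega : set M) (h : M -> 'rV[R]_1) k :
  coords D Omega h k ->
  coords [set s : R | D (const_mx s)] Omega (fun x => h x ord0 ord0)
    (fun s => k (const_mx s)).
Proof.
have row1 (y : 'rV[R]_1) : const_mx (y ord0 ord0) = y.
  by apply/rowP => j; rewrite mxE (ord1 j).
move=> [oO hc kc kO hO]; split => //.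
- move=> x Ox; apply: (continuous_comp (g := fun y : 'rV[R]_1 => y ord0 ord0)).
    exact: hc.
  exact: coord_continuous.
- move=> s; apply: (continuous_comp (f := fun s : R => const_mx s)); last exact: kc.
  apply: (row_continuous_at (g := fun=> id)) => [j y|j]; first by rewrite mxE.
  exact: cvg_id.
- by move=> s /kO[Os ->]; rewrite mxE.
- by move=> x /hO[Dx kx]; rewrite /= row1.
Qed.

Lemma half_space1 : [set s : R | half_space R 1 (const_mx s)] = nonneg.
Proof.
apply/seteqP; split=> [s /(_ ord0 erefl)|s s0 j _]; first by rewrite mxE.
by rewrite mxE.
Qed.

(** A half-line chart is split into its interior, a line chart, and its endpoint. Finitely many
    charts suffice by compactness. *)
Lemma line_cover : manifold R 1 M -> compact [set: M] ->
  exists l : seq (set M),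
    (forall L, L \in l -> exists beta b, coords [set: R] L beta b) /\
    forall q, (exists2 L, L \in l & L q) \/
      exists I beta b, coords nonneg I beta b /\ b 0 = q.
Proof.
move=> mM cM.
have local x : exists P : set M * set M, [/\ open P.1, P.1 x,
    exists beta b, coords [set: R] P.2 beta b &
    forall q, P.1 q -> P.2 q \/ exists I beta b, coords nonneg I beta b /\ b 0 = q].
  have [|] := manifold_coords mM (filterT : nbhs x setT).
    move=> [Om [h [k [/coords_row1 cO Ox _]]]]; exists (Om, Om).
    split => //; [by have [] := cO| |by left].
    by exists (fun x => h x ord0 ord0), (fun s => k (const_mx s)).
  move=> [Om [h [k [i0 _ [/coords_row1 + Ox _ _]]]]]; rewrite half_space1.
  set beta := fun x => h x ord0 ord0; set b := fun s => k (const_mx s) => cO.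
  exists (Om, Om `&` beta @^-1` [set s | 0 < s]); split => //.
  - by have [] := cO.
  - by exists (@ln R \o beta), (b \o @expR R); exact: half_line_interior.
  - move=> q Oq; have [_ _ _ _ Ib] := cO; have [] := Ib _ Oq.
    rewrite {1}/nonneg /= => q0 bq; have [lt|le] := ltP 0 (beta q); [by left|right].
    have b0 : beta q = 0 by apply/eqP; rewrite eq_le le q0.
    by exists Om, beta, b; rewrite -b0.
have [P PP] := choice local.
(* Finite lists are filtered by inclusion, so that the near-covering form of compactness produces a
   finite list of centres. *)
pose F : set_system (seq M) :=
  filter_from [set: seq M] (fun s => [set t | {subset s <= t}]).
have FF : Filter F.
  apply: filter_from_filter; first by exists [::].
  move=> s t _ _; exists (s ++ t) => // r st.
  by split=> x xs; apply: st; rewrite mem_cat xs ?orbT.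
have [D _ DM] : \forall s \near F, [set: M] `<=`
    [set x | exists2 y, y \in s & (P y).1 x].
  move/compact_near_coveringP : cM.
  apply=> // x _; have [oP Px _ _] := PP x.
  exists ((P x).1, [set s | x \in s]) => /=.
    split; first exact: open_nbhs_nbhs.
    by exists [:: x] => // s; apply; rewrite inE.
  by move=> [y s] /= [Py xs]; exists x.
exists [seq (P x).2 | x <- D]; split.
  by move=> L /mapP[x _ ->]; have [] := PP x.
move=> q; have [x Dx xq] := DM D (fun x xD => xD) q Logic.I.
have [_ _ _ /(_ q xq)[Pq|]] := PP x; last by right.
by left; exists (P x).2 => //; apply: map_f.
Qed.

(** By compactness the ray from [p] always has an end outside itself. If the end lies in a line
    chart, the ray absorbs that chart; if it is the endpoint of a half line, the component is
    complete. *)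
Lemma boundary_component (p : M) : manifold R 1 M -> compact [set: M] ->
  boundary R 1 M p ->
  homeomorphic (connected_component [set: M] p) [set` `[(0 : R), 1]].
Proof.
move=> mM cM Bp.
have [A0 [h [k [i0 _ [/coords_row1 rA0 A0p _ _]]]]] :=
  boundary_coords mM Bp (filterT : nbhs p setT).
rewrite half_space1 in rA0.
have [l [lL lM]] := line_cover mM cM.
(* Allowing points of the ray itself makes the covering property stable when a chart is moved from
   the list into the ray. *)
have {lM} : forall q, A0 q \/ (exists2 L, L \in l & L q) \/
    exists I beta b, coords nonneg I beta b /\ b 0 = q by move=> q; right.
move: A0 A0p (fun x => h x ord0 ord0) (fun s => k (const_mx s)) rA0.
(* Induction on the number of line charts not yet absorbed by the ray. *)
have [m] := ubnP (size l); elim: m l lL => // m IH l lL lm A Ap alpha a rA cover.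
have [|q [clq nAq]] := ray_not_closed rA cM; first by exists p.
have [//|[[L Ll Lq]|[I [beta [b [lI bq]]]]]] := cover q; last first.
  by apply: (ray_finish rA lI) => //; rewrite bq.
have [beta [b lineL]] := lL L Ll.
have [alpha' [a' rA']] := ray_extend rA lineL Lq clq nAq.
apply: (IH (rem L l)) rA' _ => //.
- by move=> L' /mem_rem; exact: lL.
- by rewrite size_rem//; case: (l) Ll lm.
- by left.
move=> q'; have [Aq'|[[L' Ll' Lq']|half]] := cover q'.
- by left; left.
- have [LE|L'L] := eqVneq L' L; first by left; right; rewrite -LE.
  move: Ll'; rewrite (perm_mem (perm_to_rem Ll)) inE (negbTE L'L) /= => Ll'.
  by right; left; exists L'.
- by right; right.
Qed.

End OneDim.

(** * Schottky tuples form the required open dense set *)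

Theorem theorem4p4 (R : realType) (d : nat) (M : uniformType)
    (M_manifold : manifold R d M)
    (M_compact : compact [set: M])
    (M_boundary : boundary R d M !=set0)
    (M_components : forall x : M,
      ~ homeomorphic (connected_component [set: M] x) [set` `[(0 : R), 1]])
    (n : nat) (n_gt0 : (0 < n)%N) :
  exists U : set (prod_topology (fun _ : 'I_n => Homeo0 (boundary R d M))),
    [/\ open U, dense U &
      U `<=` [set f : 'I_n -> Homeo0 (boundary R d M) |
        discrete_space (generated_subgroup (range f))]].
Proof.
have hM : hausdorff_space M by have [] := M_manifold.
have [p Bp] := M_boundary.
case: d M_manifold M_boundary p Bp => [|[|d]] mM Bne p Bp.
(* In dimension 0, a boundary chart would provide an index in an empty type. *)
- by have [Om [h [k [[]]]]] := boundary_coords mM Bp (filterT : nbhs p setT).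
- by case: (M_components p); exact: boundary_component.
exists [set f | exists2 O, schottky_data O & schottky O f].
split; [exact: schottky_open| |]; last first.
  by move=> f [O dO Sf]; exact: schottky_discrete Sf.
move=> A [f Af] oA.
have [E entE EA] := near_tuple_entourage (open_nbhs_nbhs (conj oA Af)).
have i01 : (ord0 : 'I_d.+2) != lift ord0 ord0 by [].
have [g [gE gS]] := schottky_near mM M_compact i01 Bp f entE.
by exists g; split => //; exact: EA.
Qed.
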